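(* Let $\beta>1$ and let $\varPhi_\beta$ be the homogenized metric of the chessboard structure with values $1$ and $\beta$ (defined in the context). For $(x,y)\in\mathbb{R}^2$ put $M=\max\{|x|,|y|\}$, $m=\min\{|x|,|y|\}$. Then for every $(x,y)\in\mathbb{R}^2$: (i) if $\beta\geq\beta^c_0$, then $\varPhi_\beta(x,y)=M+(\sqrt{2}-1)m$; (ii) if $\sqrt{3/2}\leq\beta\leq\beta^c_0$, then \[ \varPhi_\beta(x,y)=\begin{cases} M+(\Lambda_3-3)m, & \text{if } 3m\leq M,\\[2pt] \dfrac{\Lambda_3-\sqrt{2}}{2}\,M+\dfrac{3\sqrt{2}-\Lambda_3}{2}\,m, & \text{if } 3m\geq M.\end{cases} \]
   Context: Chessboard structure: for $\beta>1$ let $a_\beta:\mathbb{R}^2\to\{1,\beta\}$ be $2$-periodic in each variable with, on $[0,2)\times[0,2)$, $a_\beta=\beta$ on $((0,1)\times(1,2))\cup((1,2)\times(0,1))$ and $a_\beta=1$ otherwise (so $a_\beta=1$ on all lines $x\in\mathbb{Z}$, $y\in\mathbb{Z}$). For $\varepsilon>0$ let $d^\varepsilon_\beta(0,\xi)=\inf\{\int_0^1 a_\beta(u(t)/\varepsilon)|u'(t)|\,dt:\ u\in AC([0,1];\mathbb{R}^2),\ u(0)=0,\ u(1)=\xi\}$, and $\varPhi_\beta(\xi)=\lim_{\varepsilon\to0^+}d^\varepsilon_\beta(0,\xi)$ (the limit exists). Normalized length: for $t\ge 0$ let $q(t)=\lfloor t+1\rfloor/2$ if $\lfloor t\rfloor$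 is odd and $q(t)=t-\lfloor t\rfloor/2$ if $\lfloor t\rfloor$ is even, $p(t)=t+1-q(t)$; let $\hat\sigma(t,\beta)\in(0,1)$ be the unique solution $\sigma$ of $\frac{p(t)\sigma}{\sqrt{1-\sigma^2}}+\frac{q(t)\sigma}{\sqrt{\beta^2-\sigma^2}}=1$, and $l(t,\beta)=\frac{p(t)}{\sqrt{1-\hat\sigma^2}}+\frac{\beta^2q(t)}{\sqrt{\beta^2-\hat\sigma^2}}-t-\sqrt2$ with $\hat\sigma=\hat\sigma(t,\beta)$. The number $\beta^c_0$ is the unique $\beta\in(1,\sqrt2)$ with $l(2,\beta)=0$ (existence and uniqueness are established in the paper). $\Lambda_3=\Lambda_3(\beta)=\frac{2}{\sqrt{1-\sigma_3^2}}+\frac{\beta^2}{\sqrt{\beta^2-\sigma_3^2}}$, where $\sigma_3\in(0,1)$ is the unique solution of $\frac{2\sigma}{\sqrt{1-\sigma^2}}+\frac{\sigma}{\sqrt{\beta^2-\sigma^2}}=1$ (this is the optical length of the geodesic joining $(0,0)$ to $(3,1)$ inside the strip $0\le y\le1$). *)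

(* Defs.v *)
From HB Require Import structures.
From mathcomp Require Import all_boot all_order all_algebra.
From mathcomp Require Import all_classical all_reals all_analysis.
Set Implicit Arguments. Unset Strict Implicit. Unset Printing Implicit Defensive.
Import Order.TTheory GRing.Theory Num.Theory.
Import numFieldNormedType.Exports.
Local Open Scope classical_set_scope.
Local Open Scope ring_scope.

Section Chessboard.
Variable R : realType.

Definition mod2 (x : R) : R := x - 2 * (Num.floor (x / 2))%:~R.

Definition a_beta (beta : R) (x y : R) : R :=
  let x' := mod2 x in let y' := mod2 y in
  if ((0 < x' < 1) && (1 < y' < 2)) || ((1 < x' < 2) && (0 < y' < 1))
  then beta else 1.

Definition enorm (v : R * R) : R := Num.sqrt (v.1 ^+ 2 + v.2 ^+ 2).

Definition AC01 (u : R -> R * R) : Prop :=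
  forall e : R, 0 < e -> exists2 d : R, 0 < d &
    forall (n : nat) (a b : 'I_n -> R),
      (forall i, 0 <= a i /\ a i <= b i /\ b i <= 1) ->
      (forall i j, i != j -> b i <= a j \/ b j <= a i) ->
      \sum_(i < n) (b i - a i) < d ->
      \sum_(i < n) enorm ((u (b i)).1 - (u (a i)).1, (u (b i)).2 - (u (a i)).2) < e.

(* |u'(t)| (defined a.e. for absolutely continuous u) *)
Definition speed (u : R -> R * R) (t : R) : R :=
  enorm (derive1 (fun s => (u s).1) t, derive1 (fun s => (u s).2) t).

Definition olength (beta eps : R) (u : R -> R * R) : \bar R :=
  (\int[lebesgue_measure]_(t in `[0%R, 1%R]%classic)
     (a_beta beta ((u t).1 / eps) ((u t).2 / eps) * speed u t)%:E)%E.

Definition d_eps (beta eps : R) (xi : R * R) : \bar R :=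
  ereal_inf [set olength beta eps u | u in
    [set u | AC01 u /\ u 0 = (0, 0) /\ u 1 = xi]].

Definition Phi (beta : R) (xi : R * R) : \bar R :=
  lim (d_eps beta eps xi @[eps --> 0^'+]).

Definition qn (t : R) : R :=
  let k := Num.floor t in
  if odd `|k|%N then (k + 1)%:~R / 2 else t - k%:~R / 2.
Definition pn (t : R) : R := t + 1 - qn t.

Definition sigma_hat (t beta : R) : R :=
  xget 0 [set s : R | 0 < s < 1 /\
    pn t * s / Num.sqrt (1 - s ^+ 2) + qn t * s / Num.sqrt (beta ^+ 2 - s ^+ 2) = 1].

Definition l_len (t beta : R) : R :=
  let s := sigma_hat t beta in
  pn t / Num.sqrt (1 - s ^+ 2) + beta ^+ 2 * qn t / Num.sqrt (beta ^+ 2 - s ^+ 2)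
  - t - Num.sqrt 2.

(* beta^c_0 : the unique beta in (1, sqrt 2) with l(2, beta) = 0 *)
Definition beta0c : R :=
  xget 0 [set b : R | 1 < b < Num.sqrt 2 /\ l_len 2 b = 0].

Definition sigma3 (beta : R) : R :=
  xget 0 [set s : R | 0 < s < 1 /\
    2 * s / Num.sqrt (1 - s ^+ 2) + s / Num.sqrt (beta ^+ 2 - s ^+ 2) = 1].

Definition Lambda3 (beta : R) : R :=
  2 / Num.sqrt (1 - sigma3 beta ^+ 2)
  + beta ^+ 2 / Num.sqrt (beta ^+ 2 - sigma3 beta ^+ 2).

End Chessboard.

(* Main.v *)
(* Upper bounds: a multiple of (1, 1), (2, 0) or (3, 1) is reached by repeating a
   diagonal of a fast square, a grid line, or the refracted geodesic of a strip.

   Lower bounds: a function [w] on the plane at bounded distance from a linear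
   form [p], which is 1-Lipschitz on every closed fast square and
   [beta]-Lipschitz overall, calibrates the length: [w] grows along a curve at
   most as fast as the optical length, so the metric is at least [p].  On fast
   squares [w] is a max-min of six affine functions, two of which have the
   direction of the refracted ray as gradient; the boundary values so prescribed
   on a slow square are [beta]-Lipschitz because no ray crossing the strip beats
   Snell's law, and they extend inside by McShane's formula.  Almost every time a curve spends
   on a grid line its normal velocity vanishes, so the grid lines cost nothing
   extra.  That a curve grows by the integral of its derivative is Lebesgue's
   theorem for absolutely continuous functions: the total variation defines a
   Stieltjes measure dominated by the Lebesgue measure, and its Radon-Nikodym
   density is the derivative by Lebesgue differentiation. *)

Require Import Defs.
From HB Require Import structures.
From mathcomp Require Import all_boot all_order all_algebra.
From mathcomp Require Import all_classical all_reals all_analysis.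
From mathcomp Require Import measurable_realfun zify ring lra.
Import Order.TTheory GRing.Theory Num.Theory.
Import numFieldNormedType.Exports.
Set Implicit Arguments.
Unset Strict Implicit.
Unset Printing Implicit Defensive.
Local Open Scope classical_set_scope.
Local Open Scope ring_scope.

(** * Absolutely continuous functions *)

(** For [0 <= m <= M] each claimed formula is linear on the cone between two of the vectors
    [(1, 1)], [(2, 0)], [(3, 1)], whose lengths are [sqrt 2], [2] and [Lambda3]. One calibration per
    cone is therefore enough: that of the linear form exact on both generators. All these forms
    belong to the family [(1 - d, c - 1 + d)], whose value [2 - 2 * d + c] on [(3, 1)] may not
    exceed [Lambda3]. The critical value is where [Lambda3 = 2 + sqrt 2]: there the refracted ray to
    [(3, 1)] ties with a diagonal followed by a grid line. The constant [sqrt (3 / 2)] comes from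
    the slow square: between some of its edges the prescribed values are controlled by the slope
    [(1, 1 / sqrt 2)], whose norm must be at most [beta].

    The obstacle in the lower bound is the grid: the coefficient drops to 1 on it, while [w] is only
    [beta]-Lipschitz across it. Moreover [w] need not be differentiable, so no chain rule applies;
    the composite of [w] with the curve is absolutely continuous and is differentiated instead. *)

Lemma open_interval_bounds (R : realType) (I : set R) (p q : R) :
  open I -> is_interval I -> I `<=` `]p, q[ -> I !=set0 ->
  [/\ p <= inf I, inf I < sup I, sup I <= q,
      I `<=` `]inf I, sup I] & `]inf I, sup I[ `<=` I].
Proof.
move=> oI iI Ipq [x0 Ix0].
have hl : has_lbound I by exists p => y /Ipq/=; rewrite in_itv/= => /andP[/ltW].
have hu : has_ubound I by exists q => y /Ipq/=; rewrite in_itv/= => /andP[_ /ltW].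
have lo x : I x -> inf I < x.
  move=> Ix; have /nbhs_ballP[e/= e0 be] := open_nbhs_nbhs (conj oI Ix).
  apply: (@le_lt_trans _ _ (x - e / 2)); last by lra.
  apply: ge_inf => //; apply: be; rewrite /ball/=.
  by rewrite opprB addrCA subrr addr0 gtr0_norm; lra.
have hi x : I x -> x < sup I.
  move=> Ix; have /nbhs_ballP[e/= e0 be] := open_nbhs_nbhs (conj oI Ix).
  apply: (@lt_le_trans _ _ (x + e / 2)); first by lra.
  apply: ub_le_sup => //; apply: be; rewrite /ball/=.
  by rewrite opprD addrA subrr add0r normrN gtr0_norm; lra.
split.
- apply: lb_le_inf; first by exists x0.
  by move=> y /Ipq/=; rewrite in_itv/= => /andP[/ltW].
- by rewrite (lt_trans (lo _ Ix0)) ?hi.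
- apply: ge_sup; first by exists x0.
  by move=> y /Ipq/=; rewrite in_itv/= => /andP[_ /ltW].
- by move=> y Iy /=; rewrite in_itv/= lo//= ltW// hi.
- move=> y /=; rewrite in_itv/= => /andP[ay yb].
  have [z1 Iz1 z1y] : exists2 z, I z & z < y.
    have /inf_adherent : has_inf I by split => //; exists x0.
    move=> /(_ (y - inf I)); rewrite subr_gt0 => /(_ ay)[z Iz zy].
    by exists z => //; lra.
  have [z2 Iz2 z2y] : exists2 z, I z & y < z.
    have /sup_adherent : has_sup I by split => //; exists x0.
    move=> /(_ (sup I - y)); rewrite subr_gt0 => /(_ yb)[z Iz zy].
    by exists z => //; lra.
  by apply: (iI _ _ Iz1 Iz2); rewrite (ltW z1y) ltW.
Qed.

(** The domain [D] is a parameter because functions on [[0, 1]] are later extended to the whole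
    line. *)
Definition absolutely_continuous_on (R : realType) (D : set R) (g : R -> R) : Prop :=
  forall e : R, 0 < e -> exists2 d : R, 0 < d &
    forall (n : nat) (a b : 'I_n -> R),
      (forall i, [/\ D (a i), a i <= b i & D (b i)]) ->
      (forall i j, i != j -> b i <= a j \/ b j <= a i) ->
      \sum_(i < n) (b i - a i) < d ->
      \sum_(i < n) `|g (b i) - g (a i)| < e.

Lemma stieltjes_ocitv (R : realType) (G : cumulative R R) (a b : R) : a <= b ->
  lebesgue_stieltjes_measure G `]a, b] = (G b - G a)%:E.
Proof.
move=> ab; rewrite /lebesgue_stieltjes_measure /measure_extension.
rewrite measurable_mu_extE/=; last exact: is_ocitv.
by rewrite wlength_itv_bnd.
Qed.

(** An open set is a disjoint union of countably many open intervals. Finitely many of them form an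
    admissible family of total length below [d], so every partial sum of their Stieltjes measures is
    below [e]; the limit keeps the weak inequality. *)
Lemma stieltjes_open_lt (R : realType) (G : cumulative R R) (p q e d : R) :
  (forall (n : nat) (a b : 'I_n -> R), (forall i, a i <= b i) ->
      (forall i j, i != j -> b i <= a j \/ b j <= a i) ->
      \sum_(i < n) (b i - a i) < d -> \sum_(i < n) `|G (b i) - G (a i)| < e) ->
  forall U : set R, open U -> U `<=` `]p, q[ ->
  (lebesgue_measure U < d%:E)%E -> (lebesgue_stieltjes_measure G U <= e%:E)%E.
Proof.
move=> ac U oU Upq Ud.
pose I := open_disjoint_itv oU.
have oI n : open (I n) by exact: open_disjoint_itv_open.
have mI n : measurable (I n) by exact: open_measurable.
have iI n : is_interval (I n) by exact: open_disjoint_itv_is_interval.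
have tI : trivIset setT I by exact: open_disjoint_itv_trivIset.
have UI : U = \bigcup_n I n by exact: open_disjoint_itv_bigcup.
have Ipq n : I n `<=` `]p, q[.
  by move=> x Ix; apply: Upq; rewrite UI; exists n.
(* Empty members of the enumeration become the degenerate interval at [p], which lies to the left of
   all others. *)
pose a n := if pselect (I n !=set0) then inf (I n) else p.
pose b n := if pselect (I n !=set0) then sup (I n) else p.
have abP n : [/\ p <= a n, a n <= b n, I n `<=` `]a n, b n],
     `]a n, b n[ `<=` I n & a n < b n \/ b n = p].
  rewrite /a /b; case: pselect => [I0|I0].
    have [? ? ? ? ?] := open_interval_bounds (oI n) (iI n) (@Ipq n) I0.
    by split => //; [exact: ltW | left].
  split => //; last by right.
    by move=> x Ix; exfalso; apply: I0; exists x.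
  by move=> x /=; rewrite in_itv/= => /andP[px /(lt_trans px)]; rewrite ltxx.
have disj i j : i != j -> b i <= a j \/ b j <= a i.
  move=> ij.
  have [pi abi _ sub_i ei] := abP i; have [pj abj _ sub_j ej] := abP j.
  case: ei => [lti|->]; last by left.
  case: ej => [ltj|->]; last by right.
  have [|bj] := leP (b i) (a j); first by left.
  have [|bi] := leP (b j) (a i); first by right.
  exfalso.
  (* The midpoint of an overlap would belong to two disjoint components. *)
  pose m := (Num.max (a i) (a j) + Num.min (b i) (b j)) / 2.
  have lt1 : Num.max (a i) (a j) < Num.min (b i) (b j).
    by rewrite gt_max !lt_min lti ltj bj bi.
  have hm : [/\ a i < m, a j < m, m < b i & m < b j].
    have h1 : a i <= Num.max (a i) (a j) by rewrite le_max lexx.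
    have h2 : a j <= Num.max (a i) (a j) by rewrite le_max lexx orbT.
    have h3 : Num.min (b i) (b j) <= b i by rewrite ge_min lexx.
    have h4 : Num.min (b i) (b j) <= b j by rewrite ge_min lexx orbT.
    by rewrite /m; split; lra.
  case: hm => h1 h2 h3 h4.
  have : (I i `&` I j) m.
    by split; [apply: sub_i|apply: sub_j]; rewrite /= in_itv/= ?h1 ?h2 ?h3 ?h4.
  move=> Iij; move/eqP: ij; apply.
  by apply: (tI i j) => //; exists m.
have muI n : ((b n - a n)%:E <= lebesgue_measure (I n))%E.
  have [_ ab _ sub _] := abP n.
  apply: (@le_trans _ _ (lebesgue_measure `]a n, b n[%classic)).
    by rewrite lebesgue_measure_itv/= lte_fin; case: ltP => // ba;
       rewrite lee_fin; lra.
  apply: le_measure; rewrite ?inE; [exact: measurable_itv|exact: mI|exact: sub].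
have nuI n : (lebesgue_stieltjes_measure G (I n) <= (G (b n) - G (a n))%:E)%E.
  have [_ ab sub _ _] := abP n.
  rewrite -stieltjes_ocitv//.
  apply: le_measure; rewrite ?inE; [exact: mI|exact: measurable_itv|exact: sub].
have -> : lebesgue_stieltjes_measure G U
    = (\sum_(0 <= n <oo) lebesgue_stieltjes_measure G (I n))%E.
  rewrite UI; apply/esym/cvg_lim => //.
  by apply: measure_sigma_additive.
have lamU : lebesgue_measure U = (\sum_(0 <= n <oo) lebesgue_measure (I n))%E.
  rewrite UI; apply/esym/cvg_lim => //.
  by apply: measure_sigma_additive.
apply: lime_le; first by apply: is_cvg_nneseries => n _ _.
near=> n.
rewrite big_mkord.
apply: (@le_trans _ _ (\sum_(i < n) `|G (b i) - G (a i)|)%:E).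
  rewrite -sumEFin; apply: lee_sum => i _; apply: le_trans (nuI _) _.
  by rewrite lee_fin ler_norm.
rewrite lee_fin ltW//; apply: (ac n (fun i => a i) (fun i => b i)).
- by move=> i; case: (abP i).
- by move=> i j ij; exact: disj.
rewrite -lte_fin; apply: le_lt_trans Ud.
rewrite lamU -sumEFin.
apply: (@le_trans _ _ (\sum_(0 <= i < n) lebesgue_measure (I i))%E).
  by rewrite big_mkord; apply: lee_sum => i _; exact: muI.
by apply: nneseries_lim_ge => i _ _.
Unshelve. all: by end_near. Qed.

(** Composition with [clip] extends a function on [[0, 1]] by constants; a normalized monotone one
    becomes a distribution function on the line. *)
Definition clip (R : realType) (x : R) : R := Num.max 0 (Num.min x 1).

Lemma clip_itv (R : realType) (x : R) : 0 <= clip x <= 1.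
Proof. by rewrite /clip le_max lexx/= ge_max ler01 ge_min lexx orbT. Qed.

Lemma clip_id (R : realType) (x : R) : 0 <= x <= 1 -> clip x = x.
Proof. by move=> /andP[x0 x1]; rewrite /clip min_l// max_r. Qed.

Lemma clip_le0 (R : realType) (x : R) : x <= 0 -> clip x = 0.
Proof. by move=> x0; rewrite /clip max_l// ge_min x0. Qed.

Lemma clip_ge1 (R : realType) (x : R) : 1 <= x -> clip x = 1.
Proof. by move=> x0; rewrite /clip min_r// max_r. Qed.

Lemma clip_nd (R : realType) (x y : R) : x <= y -> clip x <= clip y.
Proof.
by move=> xy; rewrite /clip; apply: le_max2 => //; apply: le_min2.
Qed.

Lemma clip_lip (R : realType) (x y : R) : x <= y -> clip y - clip x <= y - x.
Proof.
move=> xy; rewrite /clip.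
have [hx|hx] := leP x 1; have [hy|hy] := leP y 1;
  have [h0|h0] := leP 0 x; have [h1|h1] := leP 0 y;
  rewrite ?(max_r ler01); lra.
Qed.

Lemma ac_clip (R : realType) (g : R -> R) :
  absolutely_continuous_on `[0, 1]%classic g ->
  absolutely_continuous_on setT (g \o @clip R).
Proof.
move=> acg e /acg[d d0 gd]; exists d => // n a b ab disj abd.
apply: (gd n (fun i => clip (a i)) (fun i => clip (b i))).
- move=> i; have [_ h _] := ab i; split; rewrite /= ?in_itv/= ?clip_itv//.
  exact: clip_nd.
- by move=> i j /disj[] /clip_nd; [left|right].
- apply: le_lt_trans abd; apply: ler_sum => i _; apply: clip_lip.
  by case: (ab i).
Qed.

(** * The Stieltjes measure of a monotone absolutely continuous function *)

Section density.
Variables (R : realType) (g : R -> R).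
Hypothesis g_nd : {in `[0, 1] &, {homo g : x y / x <= y}}.
Hypothesis g_ac : absolutely_continuous_on `[0, 1]%classic g.
Hypotheses (g0 : g 0 = 0) (g1 : g 1 = 1).

Let G := g \o @clip R.

Let G_nd : {homo G : x y / x <= y}.
Proof. by move=> x y xy; apply: g_nd; rewrite ?in_itv/= ?clip_itv// clip_nd. Qed.

Let G_rc (x : R) : G @ at_right x --> G x.
Proof.
apply/cvgrPdist_lt => e e0.
have [d d0 Gd] := ac_clip g_ac e0.
near=> y.
have xy : x <= y by near: y; exact: nbhs_right_ge.
have yd : y - x < d.
  by rewrite ltrBlDr addrC; near: y; apply: nbhs_right_lt; rewrite ltrDl.
have := Gd 1%N (fun=> x) (fun=> y).
rewrite !big_ord1 distrC; apply => //.
by move=> i j; rewrite !ord1 eqxx.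
Unshelve. all: by end_near. Qed.

Let G_Ny : G @ -oo --> (0 : R).
Proof.
apply: cvg_near_cst; near=> x.
by rewrite /G/= clip_le0 ?g0//; near: x; exact: nbhs_ninfty_le.
Unshelve. all: by end_near. Qed.

Let G_y : G @ +oo --> (1 : R).
Proof.
apply: cvg_near_cst; near=> x.
by rewrite /G/= clip_ge1 ?g1//; near: x; exact: nbhs_pinfty_ge.
Unshelve. all: by end_near. Qed.

HB.instance Definition _ := @isCumulative.Build R _ R G G_nd G_rc.
HB.instance Definition _ := @isCumulativeBounded.Build R 0 1 G G_Ny G_y.

Let GC : cumulative R R := G.
Let GB : cumulativeBounded (0 : R) (1 : R) := G.
Let nu : probability (measurableTypeR R) R := lebesgue_stieltjes_measure GB.

Let nuE (a b : R) : a <= b -> nu `]a, b]%classic = (G b - G a)%:E.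
Proof. exact: (stieltjes_ocitv GB). Qed.

(** Outer regularity covers a null set by an open set of measure below the [d] that belongs to [e].
    Cutting with []-1, 2[] makes this set bounded, and the points of the null set lost by the cut
    lie outside []-1, 1]], where [nu] vanishes because [g] is normalized. *)
Let nu_dominated : nu `<< (@lebesgue_measure R).
Proof.
apply/null_content_dominatesP => N mN N0.
have nuC : nu (~` `]-1, 1]%classic) = 0%E.
  rewrite probability_setC; last exact: measurable_itv.
  rewrite nuE; last by lra.
  by rewrite /G/= clip_ge1// clip_le0 ?g0 ?g1 ?subr0 ?subee//; lra.
apply/eqP; rewrite eq_le measure_ge0 andbT.
apply/lee_addgt0Pr => e e0; rewrite add0e.
have [d d0 Gd] := ac_clip g_ac e0.
have [U [oU NU Ud]] := lebesgue_regularity_outer mN (eq_ind_r (fun x => (x < +oo)%E) (ltry 0) N0) d0.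
pose V := U `&` `]-1, 2[%classic.
have oV : open V by apply: openI => //; exact: itv_open.
have mV : measurable V by exact: open_measurable.
have Vd : (lebesgue_measure V < d%:E)%E.
  apply: le_lt_trans Ud.
  apply: (@le_trans _ _ (lebesgue_measure ((U `\` N) `|` N))).
    apply: le_measure; rewrite ?inE//.
      by apply: measurableU => //; apply: measurableD => //; exact: open_measurable.
    by move=> x [Ux _]; have [Nx|Nx] := pselect (N x); [right|left].
  apply: (@le_trans _ _ (lebesgue_measure (U `\` N) + lebesgue_measure N)%E).
    by apply: measureU2 => //; apply: measurableD => //; exact: open_measurable.
  by rewrite [X in (_ + X)%E]N0 adde0.
have nuV : (nu V <= e%:E)%E.
  apply: (@stieltjes_open_lt R GC (-1) 2 e d) => //.
  - move=> n a b ab disj abd; apply: Gd => //.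
  - by move=> x [].
apply: (@le_trans _ _ (nu (V `|` ~` `]-1, 1]%classic))).
  apply: le_measure; rewrite ?inE//; first by apply: measurableU => //; apply: measurableC; exact: measurable_itv.
  move=> x Nx; have [h|h] := pselect (`]-1, 1]%classic x); last by right.
  left; split; first exact: NU.
  by move: h; rewrite /= !in_itv/= => /andP[-> /le_lt_trans]; apply; rewrite ltr1n.
set W := ~` _; apply: (@le_trans _ _ (nu V + nu W)%E).
  by apply: measureU2 => //; apply: measurableC; exact: measurable_itv.
by rewrite [X in (_ + X)%E]nuC adde0.
Qed.

Lemma monotone_ac_density : exists2 h : R -> R,
  (@lebesgue_measure R).-integrable setT (EFin \o h) &
  forall x, 0 <= x <= 1 ->
    g x = (\int[@lebesgue_measure R]_(t in [set` `]0, x]]) h t)%R.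
Proof.
have [h [h0 hfin hint hE]] := radon_nikodym_sigma_finite nu_dominated.
have hh : h = EFin \o (fine \o h) by apply/funext => x /=; rewrite fineK.
exists (fine \o h); first by rewrite -hh.
move=> x x01; have [x0 x1] := andP x01.
transitivity (fine (nu `]0, x]%classic)).
  by rewrite nuE//= /G/= clip_id// clip_le0// g0 subr0.
by congr fine; rewrite {1}hh in hE; apply: hE; exact: measurable_itv.
Qed.

End density.

Lemma itv_partition_nth (R : realType) (a b : R) (s : seq R) (k : nat) :
  itv_partition a b s ->
  [/\ a <= nth b (a :: s) k, nth b (a :: s) k <= nth b (a :: s) k.+1
    & nth b (a :: s) k.+1 <= b].
Proof.
elim: s a k => [|x s IH] a k abs.
  by rewrite -(itv_partition_nil abs) /= !nth_nil; case: k => /= *; rewrite ?nth_nil; split.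
have xs := itv_partition_cons abs.
have ax : a <= x by case: abs => /= /andP[/ltW].
case: k => [|k] /=.
  by have [h1 h2 h3] := IH x 0%N xs; split => //; rewrite (le_trans h2 h3).
by have [h1 h2 h3] := IH x k xs; split => //; exact: le_trans h1.
Qed.

Lemma itv_partition_nth_homo (R : realType) (a b : R) (s : seq R) (k l : nat) :
  itv_partition a b s -> (k <= l)%N -> nth b (a :: s) k <= nth b (a :: s) l.
Proof.
move=> abs; elim: l => [|l IH]; first by rewrite leqn0 => /eqP ->.
rewrite leq_eqVlt => /predU1P[->//|]; rewrite ltnS => /IH h.
by apply: le_trans h _; case: (itv_partition_nth l abs).
Qed.

(** Brings partitions of different sizes to a common index range: past its end the list takes the
    default value [b], which adds zero increments. *)
Lemma variation_ord (R : realType) (f : R -> R) (a b : R) (s : seq R) (m : nat) :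
  itv_partition a b s -> (size s <= m)%N ->
  variation a b f s =
  \sum_(k < m) `|f (nth b (a :: s) k.+1) - f (nth b (a :: s) k)|.
Proof.
move=> abs sm; rewrite /variation -(big_mkord xpredT
  (fun k => `|f (nth b (a :: s) k.+1) - f (nth b (a :: s) k)|)).
rewrite [RHS](big_cat_nat (n := size s))//=.
rewrite [X in _ + X]big1_seq ?addr0// => k /andP[_].
rewrite mem_index_iota => /andP[sk _].
rewrite nth_default//.
suff -> : nth b (a :: s) k = b by rewrite subrr normr0.
have [sk'|ks] := ltnP (size s) k; first by rewrite nth_default.
have -> : k = size s by apply/eqP; rewrite eqn_leq ks sk.
by rewrite nth_last/=; case: abs => _ /eqP.
Qed.

(** The cells of all partitions, indexed by pairs in ['I_n * 'I_m], form a single disjoint family of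
    no larger total length, to which absolute continuity applies. *)
Lemma ac_variation_lt (R : realType) (D : set R) (f : R -> R) (e d : R)
    (n : nat) (a b : 'I_n -> R) (s : 'I_n -> seq R) :
  is_interval D ->
  (forall (n : nat) (a b : 'I_n -> R),
      (forall i, [/\ D (a i), a i <= b i & D (b i)]) ->
      (forall i j, i != j -> b i <= a j \/ b j <= a i) ->
      \sum_(i < n) (b i - a i) < d ->
      \sum_(i < n) `|f (b i) - f (a i)| < e) ->
  (forall i, [/\ D (a i), a i <= b i & D (b i)]) ->
  (forall i j, i != j -> b i <= a j \/ b j <= a i) ->
  (forall i, itv_partition (a i) (b i) (s i)) ->
  \sum_(i < n) (b i - a i) < d ->
  \sum_(i < n) variation (a i) (b i) f (s i) < e.
Proof.
move=> iD ac ab disj abs abd.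
pose m := (\max_(i < n) size (s i))%N.
have sm i : (size (s i) <= m)%N by exact: (leq_bigmax i).
pose T := ('I_n * 'I_m)%type.
pose pt (i : 'I_n) k := nth (b i) (a i :: s i) k.
have := ac #|{: T}| (fun x => pt (enum_val x).1 (enum_val x).2)
                  (fun x => pt (enum_val x).1 (enum_val x).2.+1).
have sumE F : \sum_(i < n) \sum_(k < m) F i k =
    \sum_(x < #|{: T}|) F (enum_val x).1 (enum_val x).2 :> R.
  rewrite pair_big/=.
  rewrite -(@big_enum_val _ _ _ T predT (fun x : T => F x.1 x.2))/=.
  by apply: eq_bigl => x; rewrite inE.
rewrite -(sumE (fun i k => pt i k.+1 - pt i k)).
rewrite -(sumE (fun i (k : 'I_m) => `|f (pt i k.+1) - f (pt i k)|)).
have <- : \sum_(i < n) variation (a i) (b i) f (s i) =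
    \sum_(i < n) \sum_(k < m) `|f (pt i k.+1) - f (pt i k)|.
  by apply: eq_bigr => i _; exact: variation_ord.
apply.
- move=> x; have [h1 h2 h3] := itv_partition_nth (enum_val x).2 (abs (enum_val x).1).
  have [d1 d2 d3] := ab (enum_val x).1; rewrite /pt; split => //.
  + by apply: (iD _ _ d1 d3); rewrite h1 (le_trans h2 h3).
  + by apply: (iD _ _ d1 d3); rewrite h3 (le_trans h1 h2).
- move=> x y xy; set i := (enum_val x).1; set j := (enum_val y).1.
  set k := (enum_val x).2; set l := (enum_val y).2.
  have [ij|ij] := eqVneq i j.
    have kl : val k != val l.
      apply: contra xy => /eqP/val_inj kl; apply/eqP/enum_val_inj.
      by rewrite (surjective_pairing (enum_val x)) (surjective_pairing (enum_val y)); congr pair.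
    rewrite ij; case: (ltngtP k l) kl => // kl _.
      by left; exact: itv_partition_nth_homo.
    by right; exact: itv_partition_nth_homo.
  have [h1 h2 h3] := itv_partition_nth k (abs i).
  have [h4 h5 h6] := itv_partition_nth l (abs j).
  by case: (disj _ _ ij) => h; [left|right];
    [apply: le_trans h3 (le_trans h h4)|apply: le_trans h6 (le_trans h h1)].
- apply: le_lt_trans abd; apply: ler_sum => i _.
  rewrite -(big_mkord xpredT (fun k => pt i k.+1 - pt i k)) telescope_sumr//.
  rewrite /pt/= lerB//.
  case: m {T sumE} sm => [|m] sm /=; first by case: (ab i).
  by have [] := itv_partition_nth m (abs i).
Qed.

Lemma ac_dominated (R : realType) (D : set R) (f g : R -> R) (K : R) :
  (forall x y, D x -> D y -> x <= y -> `|g y - g x| <= K * `|f y - f x|) ->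
  absolutely_continuous_on D f -> absolutely_continuous_on D g.
Proof.
move=> gf acf e e0; pose K' := Num.max K 1.
have K'0 : 0 < K' by rewrite lt_max ltr01 orbT.
have [d d0 fd] := acf (e / K') (divr_gt0 e0 K'0).
exists d => // n a b ab disj abd.
apply: le_lt_trans (_ : _ <= K' * \sum_(i < n) `|f (b i) - f (a i)|) _.
  rewrite mulr_sumr; apply: ler_sum => i _; have [Da h Db] := ab i.
  apply: le_trans (gf _ _ Da Db h) _; apply: ler_wpM2r => //.
  by rewrite le_max lexx.
by rewrite mulrC -ltr_pdivlMr//; exact: fd.
Qed.

Lemma acD (R : realType) (D : set R) (f g : R -> R) :
  absolutely_continuous_on D f -> absolutely_continuous_on D g ->
  absolutely_continuous_on D (f \+ g).
Proof.
move=> acf acg e e0.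
have [d d0 fd] := acf (e / 2) (divr_gt0 e0 (ltr0Sn _ 1)).
have [c c0 gc] := acg (e / 2) (divr_gt0 e0 (ltr0Sn _ 1)).
exists (Num.min d c); first by rewrite lt_min d0.
move=> n a b ab disj; rewrite lt_min => /andP[abd abc].
apply: le_lt_trans (_ : _ <= \sum_(i < n) `|f (b i) - f (a i)| + \sum_(i < n) `|g (b i) - g (a i)|) _.
  rewrite -big_split/=; apply: ler_sum => i _.
  by rewrite opprD addrACA; exact: ler_normD.
by rewrite (splitr e); apply: ltrD; [exact: fd|exact: gc].
Qed.

Lemma ac_id (R : realType) (D : set R) : absolutely_continuous_on D idfun.
Proof.
move=> e e0; exists e => // n a b ab _.
suff -> : \sum_(i < n) `|idfun (b i) - idfun (a i)| = \sum_(i < n) (b i - a i) by [].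
by apply: eq_bigr => i _; rewrite /= ger0_norm// subr_ge0; case: (ab i).
Qed.

(** * Total variation of an absolutely continuous function *)

Section total_variation_ac.
Variables (R : realType) (f : R -> R).
Hypothesis acf : absolutely_continuous_on `[0, 1]%classic f.

Local Notation TV := (@total_variation R).

Let itv01 : is_interval (`[0, 1]%classic : set R).
Proof. exact: interval_is_interval. Qed.

Lemma ac_bounded_variation : bounded_variation 0 1 f.
Proof.
have [d d0 fd] := acf ltr01.
have TV1 x y : 0 <= x -> x <= y -> y <= 1 -> y - x < d -> (TV x y f <= 1)%E.
  move=> x0 xy y1 yxd; apply: ge_ereal_sup => _ [_ [s xys <-] <-].
  rewrite lee_fin ltW//.
  have := @ac_variation_lt R _ f 1 d 1%N (fun=> x) (fun=> y) (fun=> s) itv01 fd.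
  rewrite !big_ord1; apply => //.
    by move=> _; rewrite /= !in_itv/= x0 xy y1 (le_trans x0 xy) (le_trans xy y1).
  by move=> i j; rewrite !ord1 eqxx.
apply/bounded_variationP; first exact: ler01.
(* Intervals shorter than [d] have variation at most 1, and additivity of the variation advances by
   steps of length [d / 2]. *)
suff H n (x : R) : 0 <= x <= 1 -> x <= n%:R * (d / 2) -> TV 0 x f \is a fin_num.
  apply: (H (Num.bound (2 / d))); first by rewrite ler01 lexx.
  rewrite mulrA ler_pdivlMr// mul1r -ler_pdivrMr// ltW//.
  by apply: archi_boundP; rewrite divr_ge0// ltW.
elim: n x => [|n IH] x /andP[x0 x1] xn.
  have -> : x = 0 by apply/eqP; rewrite eq_le x0 andbT; move: xn; rewrite mul0r.
  by rewrite total_variationxx.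
pose y := Num.max 0 (x - d / 2).
have y0 : 0 <= y by rewrite le_max lexx.
have yx : y <= x by rewrite ge_max x0/=; lra.
rewrite (total_variationD f y0 yx) fin_numD; apply/andP; split.
  apply: IH; first by rewrite y0 (le_trans yx x1).
  rewrite ge_max mulr_ge0//=; last by lra.
  by move: xn; rewrite -natr1 mulrDl mul1r; lra.
rewrite ge0_fin_numE; last exact: total_variation_ge0.
apply: le_lt_trans (TV1 _ _ y0 yx x1 _) (ltry _).
have : x - d / 2 <= y by rewrite le_max lexx orbT.
by lra.
Qed.

Let V x := fine (TV 0 x f).

Let TVfin x y : 0 <= x -> x <= y -> y <= 1 -> TV x y f \is a fin_num.
Proof.
move=> x0 xy y1; apply/bounded_variationP => //.
apply: (bounded_variationl xy y1); apply: (bounded_variationr x0) => //.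
  exact: le_trans y1.
exact: ac_bounded_variation.
Qed.

Let VE x y : 0 <= x -> x <= y -> y <= 1 -> V y - V x = fine (TV x y f).
Proof.
move=> x0 xy y1; rewrite /V (total_variationD f x0 xy) fineD.
- by rewrite addrAC subrr add0r.
- by apply: TVfin => //; exact: le_trans y1.
- exact: TVfin.
Qed.

Lemma variation_fun_ge (x y : R) : 0 <= x -> x <= y -> y <= 1 ->
  `|f y - f x| <= fine (TV 0 y f) - fine (TV 0 x f).
Proof.
move=> x0 xy y1; rewrite VE// -lee_fin fineK; last exact: TVfin.
exact: total_variation_ge.
Qed.

Lemma variation_fun_ac :
  absolutely_continuous_on `[0, 1]%classic (fun x => fine (TV 0 x f)).
Proof.
move=> e e0; have [d d0 fd] := acf (divr_gt0 e0 (ltr0Sn _ 1)).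
exists d => // n a b ab disj abd.
have ab' i : [/\ 0 <= a i, a i <= b i & b i <= 1].
  have [h1 h2 h3] := ab i; split => //.
    by move: h1; rewrite /= in_itv/= => /andP[].
  by move: h3; rewrite /= in_itv/= => /andP[].
(* One half of [e] pays for the sums over partitions, the other for the [n] errors made in replacing
   total variations by such sums; [n.+1] keeps the denominator positive when [n] is zero. *)
pose eta := e / 2 / n.+1%:R.
have eta0 : 0 < eta by rewrite !divr_gt0// ltr0n.
have /choice[s sP] i : exists s, itv_partition (a i) (b i) s /\
    fine (TV (a i) (b i) f) - eta < variation (a i) (b i) f s.
  have [h1 h2 h3] := ab' i.
  have := TVfin h1 h2 h3; move=> /[dup] tfin /(@ub_ereal_sup_adherent _ _ _ eta0).
  move=> [_ [_ [s abs <-] <-]]; rewrite -/(total_variation _ _ _) => lt.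
  by exists s; split => //; rewrite -lte_fin EFinB fineK.
have := ac_variation_lt itv01 fd ab disj (fun i => (sP i).1) abd.
move=> vlt.
apply: le_lt_trans (_ : _ <= \sum_(i < n) (variation (a i) (b i) f (s i) + eta)) _.
  apply: ler_sum => i _; have [h1 h2 h3] := ab' i.
  rewrite ger0_norm VE//; last by rewrite fine_ge0// total_variation_ge0.
  by have := (sP i).2; lra.
rewrite big_split/= sumr_const card_ord -mulr_natl.
have : n%:R * eta <= e / 2.
  rewrite /eta mulrCA ger_pMr; last by lra.
  by rewrite ler_pdivrMr ?ltr0n// mul1r ler_nat.
by lra.
Qed.

End total_variation_ac.

Lemma monotone_ac_density_scaled (R : realType) (g : R -> R) :
  {in `[0, 1] &, {homo g : x y / x <= y}} ->
  absolutely_continuous_on `[0, 1]%classic g -> g 0 < g 1 ->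
  exists2 h : R -> R, (@lebesgue_measure R).-integrable setT (EFin \o h) &
  forall x, 0 <= x <= 1 ->
    g x - g 0 = (\int[@lebesgue_measure R]_(t in [set` `]0, x]]) h t)%R.
Proof.
move=> gnd gac g01.
pose c := g 1 - g 0; have c0 : 0 < c by rewrite subr_gt0.
pose g' x := (g x - g 0) / c.
have [||||h hint hE] := @monotone_ac_density R g'.
- move=> x y x01 y01 xy; rewrite ler_pM2r ?invr_gt0//.
  by rewrite lerD2r; exact: gnd.
- apply: (ac_dominated (K := c^-1)) gac => x y _ _ _.
  rewrite /g' -mulrBl (_ : g y - g 0 - (g x - g 0) = g y - g x); last by ring.
  by rewrite normrM (gtr0_norm (x := c^-1)) ?invr_gt0// mulrC.
- by rewrite /g' subrr mul0r.
- by rewrite /g' divff// gt_eqF.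
exists (fun x => c * h x).
  rewrite (_ : EFin \o _ = (fun x => c%:E * (EFin \o h) x)%E); last first.
    by apply/funext => x /=.
  exact: integrableZl.
move=> x x01; rewrite RintegralZl//; last exact: (integrableS measurableT).
by rewrite -hE// /g' mulrC divfK// gt_eqF.
Qed.

Lemma ac_density (R : realType) (f : R -> R) :
  absolutely_continuous_on `[0, 1]%classic f ->
  exists2 h : R -> R, (@lebesgue_measure R).-integrable setT (EFin \o h) &
  forall x, 0 <= x <= 1 ->
    f x - f 0 = (\int[@lebesgue_measure R]_(t in [set` `]0, x]]) h t)%R.
Proof.
move=> acf.
(* [f] is the difference of the nondecreasing functions [g1] and [g2]. The summand [x] makes both
   grow strictly from 0 to 1, so that they can be normalized. *)
pose g1 x := fine (total_variation 0 x f) + x.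
pose g2 x := g1 x - f x.
have Vge := variation_fun_ge acf.
have g1ac : absolutely_continuous_on `[0, 1]%classic g1.
  by apply: acD; [exact: variation_fun_ac | exact: ac_id].
have [h1 h1int h1E] : exists2 h : R -> R,
    (@lebesgue_measure R).-integrable setT (EFin \o h) &
    forall x, 0 <= x <= 1 ->
    g1 x - g1 0 = (\int[@lebesgue_measure R]_(t in [set` `]0, x]]) h t)%R.
  apply: monotone_ac_density_scaled => //.
    move=> x y; rewrite !in_itv/= => /andP[x0 _] /andP[_ y1] xy.
    by have := Vge _ _ x0 xy y1; have := normr_ge0 (f y - f x); rewrite /g1; lra.
  have := Vge 0 1 (lexx _) ler01 (lexx _).
  by have := normr_ge0 (f 1 - f 0); rewrite /g1; lra.
have [h2 h2int h2E] : exists2 h : R -> R,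
    (@lebesgue_measure R).-integrable setT (EFin \o h) &
    forall x, 0 <= x <= 1 ->
    g2 x - g2 0 = (\int[@lebesgue_measure R]_(t in [set` `]0, x]]) h t)%R.
  apply: monotone_ac_density_scaled => //.
  - move=> x y; rewrite !in_itv/= => /andP[x0 _] /andP[_ y1] xy.
    have := Vge _ _ x0 xy y1; have := ler_norm (f y - f x).
    by rewrite /g2 /g1; lra.
  - apply: acD => //; apply: (ac_dominated (K := 1)) acf => x y _ _ _.
    by rewrite -opprD normrN mul1r.
  - have := Vge 0 1 (lexx _) ler01 (lexx _).
    by have := ler_norm (f 1 - f 0); rewrite /g2 /g1; lra.
exists (fun x => h1 x - h2 x).
  rewrite (_ : EFin \o _ = ((EFin \o h1) \- (EFin \o h2))%E); last first.
    by apply/funext => x /=.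
  exact: integrableB.
move=> x x01; rewrite RintegralB//; try exact: (integrableS measurableT).
by rewrite -h1E// -h2E// /g2; lra.
Qed.

(* No measurability is assumed: the integral of a nonnegative function is a
   supremum over the simple functions below it. *)
Lemma ge0_subset_le_integral d (T : measurableType d) (R : realType)
    (mu : {measure set T -> \bar R}) (A B : set T) (f g : T -> \bar R) :
  A `<=` B -> (forall x, A x -> 0 <= f x)%E -> (forall x, B x -> 0 <= g x)%E ->
  (forall x, A x -> f x <= g x)%E ->
  (\int[mu]_(x in A) f x <= \int[mu]_(x in B) g x)%E.
Proof.
move=> AB f0 g0 fg; rewrite !ge0_integralE//.
apply: ereal_sup_le; apply: image_subset => h /= hf x; apply: le_trans (hf x) _.
rewrite !patchE; case: ifPn => [/set_mem xA|_]; first by rewrite mem_set ?fg//; exact: AB.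
by case: ifPn => // /set_mem; exact: g0.
Qed.

Lemma ac_derivable_ae (R : realType) (f : R -> R) :
  absolutely_continuous_on `[0, 1]%classic f ->
  exists2 h : R -> R,
    (@lebesgue_measure R).-integrable setT (EFin \o h) /\
    f 1 - f 0 = (\int[@lebesgue_measure R]_(t in [set` `]0, 1]]) h t)%R &
  {ae @lebesgue_measure R, forall t, 0 < t < 1 -> derivable f t 1 /\ derive1 f t = h t}.
Proof.
move=> acf; have [h hint hE] := ac_density acf.
exists h; first by split => //; rewrite hE// ler01 lexx.
have hloc : locally_integrable setT h by apply: open_integrable_locally => //; exact: openT.
have hitv y : (@lebesgue_measure R).-integrable [set` `]0, y]] (EFin \o h).
  exact: (integrableS measurableT).
have := FTC1 hitv hloc.
apply: filterS; first exact: (ae_filter_ringOfSetsType lebesgue_measure).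
move=> t /= Ft /andP[t0 t1].
have [|dF F'] := Ft; first by [].
have nearE : \forall s \near t,
    f 0 + (\int[@lebesgue_measure R]_(t in [set` `]0, s]]) h t)%R = f s.
  near=> s; rewrite -hE; first by rewrite addrC subrK.
  have : s \in `]0, 1[ by near: s; apply: near_in_itvoo; rewrite in_itv/= t0.
  by rewrite in_itv/= => /andP[/ltW -> /ltW].
have dF2 : is_derive t 1 (fun s => f 0 + (\int[@lebesgue_measure R]_(t in [set` `]0, s]]) h t)%R) (h t).
  rewrite -[h t]add0r; apply: is_deriveD.
  by rewrite -F' derive1E; exact: derivableP.
have [] := near_eq_is_derive nearE dF2.
by rewrite derive1E.
Unshelve. all: by end_near. Qed.

Lemma ac_growth (R : realType) (f S : R -> R) :
  absolutely_continuous_on `[0, 1]%classic f -> (forall t, 0 <= S t) ->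
  {ae @lebesgue_measure R, forall t, 0 < t < 1 -> derivable f t 1 -> derive1 f t <= S t} ->
  ((f 1 - f 0)%:E <= \int[@lebesgue_measure R]_(t in `[0%R, 1%R]) (S t)%:E)%E.
Proof.
move=> acf S0 aeS.
have [h [hint hE] aeh] := ac_derivable_ae acf.
have mh : measurable_fun setT h by apply/measurable_EFinP; exact: (measurable_int _ hint).
have [N [mN N0 sN]] : {ae @lebesgue_measure R, forall t, 0 < t < 1 -> h t <= S t}.
  apply: filterS2 aeh aeS; first exact: (ae_filter_ringOfSetsType lebesgue_measure).
  by move=> t h1 h2 t01; have [d <-] := h1 t01; exact: h2.
pose D : set (measurableTypeR R) := `]0, 1]%classic.
have mD : measurable D by exact: measurable_itv.
rewrite hE /Rintegral fineK; last first.
  by apply: integrable_fin_num => //; exact: (integrableS measurableT).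
have mh0 : measurable_fun D (fun t => (Num.max (h t) 0)%:E).
  by apply/measurable_EFinP; apply: measurable_maxr => //; exact: measurable_funS mh.
(* [S] is not known to be measurable. Passing to the positive part of [h] makes both integrands
   nonnegative, and their integrals then compare as suprema over simple functions. *)
apply: (@le_trans _ _ (\int[@lebesgue_measure R]_(t in D) (Num.max (h t) 0)%:E)%E).
  apply: le_integral => //.
  - exact: (integrableS measurableT).
  - apply: (@le_integrable _ _ _ _ _ mD _ (EFin \o h)) => //.
      move=> t _ /=; rewrite lee_fin ger0_norm ?le_max ?lexx ?orbT//.
      by rewrite ge_max normr_ge0 ler_norm.
    exact: (integrableS measurableT).
  - by move=> t _; rewrite lee_fin le_max lexx.
(* The endpoint 1 joins the null set because the derivative is controlled on the open interval
   only. *)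
pose N' := N `|` [set 1].
rewrite (@ge0_negligible_integral _ _ _ _ _ N')//; first last.
- by apply/eqP; rewrite eq_le measure_ge0 andbT;
  apply: le_trans (measureU2 _ _ _) _ => //;
  rewrite [X in (X + _)%E]N0 add0e [leLHS]lebesgue_measure_set1.
- by move=> x _; rewrite lee_fin le_max lexx orbT.
- by apply: measurableU => //; exact: measurable_set1.
apply: ge0_subset_le_integral => //.
- by move=> t [/= + _]; rewrite /D/= !in_itv/= => /andP[/ltW t0 t1]; apply/andP.
- by move=> x _; rewrite lee_fin le_max lexx orbT.
- by move=> x _; rewrite lee_fin.
move=> t [/= Dt Nt]; rewrite lee_fin ge_max S0 andbT.
have [//|tS] := leP (h t) (S t).
exfalso; apply: Nt; move: Dt; rewrite /D/= in_itv/= => /andP[t0].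
rewrite le_eqVlt => /predU1P[->|t1]; first by right.
left; apply: sN => /= H.
by have := H (introT andP (conj t0 t1)); rewrite leNgt tS.
Qed.

(** * Plane geometry and calibrations *)

Section plane.
Variable R : realType.
Implicit Types (a b x y L : R) (z : R * R).

Definition pdist z z' : R := enorm (z.1 - z'.1, z.2 - z'.2).

Lemma enorm_ge0 z : 0 <= enorm z.
Proof. exact: sqrtr_ge0. Qed.

Lemma enorm_ge1 a b : `|a| <= enorm (a, b).
Proof. by rewrite -sqrtr_sqr /enorm ler_sqrt ?lerDl ?sqr_ge0// addr_ge0 ?sqr_ge0. Qed.

Lemma enorm_ge2 a b : `|b| <= enorm (a, b).
Proof. by rewrite -sqrtr_sqr /enorm ler_sqrt ?lerDr ?sqr_ge0// addr_ge0 ?sqr_ge0. Qed.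

Lemma enorm_le_sqr a b L : 0 <= L -> a ^+ 2 + b ^+ 2 <= L ^+ 2 -> enorm (a, b) <= L.
Proof. by move=> L0 h; rewrite -[L]ger0_norm// -sqrtr_sqr ler_wsqrtr. Qed.

Lemma sqr_enorm a b : enorm (a, b) ^+ 2 = a ^+ 2 + b ^+ 2.
Proof. by rewrite /enorm sqr_sqrtr// addr_ge0// sqr_ge0. Qed.

Lemma enorm_le_sum a b : enorm (a, b) <= `|a| + `|b|.
Proof.
apply: enorm_le_sqr; first by rewrite addr_ge0.
rewrite sqrrD !real_normK ?num_real//.
have := mulr_ge0 (normr_ge0 a) (normr_ge0 b); rewrite -mulr_natr; lra.
Qed.

Lemma enormZ (c a b : R) : enorm (c * a, c * b) = `|c| * enorm (a, b).
Proof. by rewrite /enorm/= !exprMn -mulrDr sqrtrM ?sqr_ge0// sqrtr_sqr. Qed.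

Lemma dot_le_enorm (p q a b L : R) : 0 <= L -> p ^+ 2 + q ^+ 2 <= L ^+ 2 ->
  p * a + q * b <= L * enorm (a, b).
Proof.
move=> L0 pqL; have [h|h] := leP (p * a + q * b) 0.
  by rewrite (le_trans h)// mulr_ge0// enorm_ge0.
rewrite -(@ler_pXn2r _ 2) ?nnegrE ?(ltW h) ?mulr_ge0 ?enorm_ge0//.
rewrite exprMn sqr_enorm.
have := sqr_ge0 (p * b - q * a).
have := ler_wpM2r (addr_ge0 (sqr_ge0 a) (sqr_ge0 b)) pqL.
rewrite !expr2; nra.
Qed.

Lemma enormD (a b a' b' : R) :
  enorm (a + a', b + b') <= enorm (a, b) + enorm (a', b').
Proof.
apply: enorm_le_sqr; first by rewrite addr_ge0// enorm_ge0.
rewrite !sqrrD !sqr_enorm.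
have := @dot_le_enorm a b a' b' _ (enorm_ge0 (a, b)).
rewrite sqr_enorm => /(_ (lexx _)).
rewrite !expr2 -mulr_natr; lra.
Qed.

Lemma enormN a b : enorm (- a, - b) = enorm (a, b).
Proof. by rewrite /enorm/= !sqrrN. Qed.

Lemma pdistC z z' : pdist z z' = pdist z' z.
Proof. by rewrite /pdist -enormN !opprB. Qed.

Lemma pdist_triangle z1 z2 z3 : pdist z1 z3 <= pdist z1 z2 + pdist z2 z3.
Proof.
rewrite /pdist -[z1.1 - z3.1](subrKA z2.1) -[z1.2 - z3.2](subrKA z2.2).
exact: enormD.
Qed.

Lemma int_between (n : int) x : n%:~R < x -> x < (n + 1)%:~R -> Num.floor x = n.
Proof. by move=> h1 h2; apply: floor_def; rewrite (ltW h1) h2. Qed.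

Lemma mod2_floor x : mod2 x = x - (Num.floor x)%:~R + (~~ (2 %| Num.floor x)%Z)%:R.
Proof.
set n := Num.floor x; have := floor_itv x; rewrite -/n => /andP[nx xn].
rewrite /mod2.
have -> : Num.floor (x / 2) = (n %/ 2)%Z.
  apply: floor_def; rewrite ler_pdivlMr// ltr_pdivrMr//.
  apply/andP; split.
    apply: le_trans nx; rewrite -(intrM _ _ 2) ler_int; lia.
  apply: (lt_le_trans xn); rewrite -(intrM _ _ 2) ler_int; lia.
have e : n = 2 * (n %/ 2)%Z + (~~ (2 %| n)%Z)%:Z by lia.
have := congr1 (fun k : int => k%:~R : R) e.
rewrite /= rmorphD rmorphM /= => eR.
rewrite {1}eR; set c := (~~ _); case: c {eR e} => /=; lra.
Qed.

Lemma a_beta_ge1 (beta : R) x y : 1 < beta -> 1 <= a_beta beta x y.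
Proof. by move=> /ltW b1; rewrite /a_beta; case: ifP. Qed.

Lemma a_beta_black (beta : R) x y :
  (Num.floor x)%:~R < x -> (Num.floor y)%:~R < y ->
  ~~ (2 %| Num.floor x + Num.floor y)%Z -> a_beta beta x y = beta.
Proof.
move=> xn yn par; rewrite /a_beta !mod2_floor.
have /andP[_ xn'] := floor_itv x; have /andP[_ yn'] := floor_itv y.
rewrite !rmorphD /= in xn' yn'.
set i := Num.floor x in par xn xn' *; set j := Num.floor y in par yn yn' *.
have [ei|oi] := boolP (2 %| i)%Z; have [ej|oj] := boolP (2 %| j)%Z; try lia.
- rewrite /= addr0 (_ : 0 < x - i%:~R < 1); last by apply/andP; split; lra.
  by rewrite (_ : 1 < y - j%:~R + 1 < 2)//; apply/andP; split; lra.
- rewrite /= addr0 [in X in _ || X](_ : 1 < x - i%:~R + 1 < 2); last by apply/andP; split; lra.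
  by rewrite (_ : 0 < y - j%:~R < 1) ?orbT//; apply/andP; split; lra.
Qed.

Definition in_square (i j : int) z :=
  [/\ i%:~R <= z.1, z.1 <= i%:~R + 1, j%:~R <= z.2 & z.2 <= j%:~R + 1].

Definition calibration (beta : R) (w : R * R -> R) : Prop :=
  (forall z z', `|w z - w z'| <= beta * pdist z z') /\
  (forall i j : int, (2 %| i + j)%Z -> forall z z',
     in_square i j z -> in_square i j z' -> `|w z - w z'| <= pdist z z').

Definition integral_coord x : bool := (Num.floor x)%:~R == x.

(** Of the two squares of row [j] that share an edge on a vertical grid line, one is fast. *)
Lemma even_neighbour (n j : int) x : n%:~R = x ->
  exists k : int, [/\ (2 %| k + j)%Z, k%:~R <= x & x <= k%:~R + 1].
Proof.
move=> nx; have [e|o] := boolP (2 %| n + j)%Z.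
  by exists n; rewrite nx lexx lerDl.
exists (n - 1); rewrite rmorphB/= nx subrK lexx gerBl ler01; split => //; lia.
Qed.

(** Applied to both coordinates, this puts a point and any nearby point into a common closed square,
    which is the square of the floors when neither coordinate is integral. *)
Lemma adjacent_unit_interval x : exists2 d, 0 < d & forall x', `|x' - x| < d ->
  exists k : int, [/\ k%:~R <= x, x <= k%:~R + 1, k%:~R <= x', x' <= k%:~R + 1
    & ~~ integral_coord x -> k = Num.floor x].
Proof.
have /andP[nx] := floor_itv x; rewrite rmorphD/= => xn.
rewrite /integral_coord; set n := Num.floor x in nx xn *.
have [xE|xneq] := eqVneq n%:~R x.
  exists 1 => // x'; rewrite ltr_norml => /andP[h1 h2].
  have [x'n|x'n] := leP n%:~R x'.
    by exists n; split=> //; lra.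
  by exists (n - 1); rewrite rmorphB/=; split => //; lra.
have nx' : n%:~R < x by rewrite lt_neqAle xneq.
exists (Num.min (x - n%:~R) (n%:~R + 1 - x)); first by rewrite lt_min !subr_gt0 nx'.
move=> x'; rewrite lt_min !ltr_norml => /andP[/andP[h1 h2] /andP[h3 h4]].
by exists n; split => //; lra.
Qed.

(** On a grid line the coefficient is 1. From [z'] one first moves perpendicularly to the line
    through [z], at rate [beta], and then along that line, at rate 1, since it bounds a fast square.
    The perpendicular moves are the last two terms, present only on the grid; at a vertex they
    already bound the whole increment. *)
Lemma calibration_local (beta : R) w z : 1 < beta -> calibration beta w ->
  exists2 d : R, 0 < d & forall z', `|z'.1 - z.1| < d -> `|z'.2 - z.2| < d ->
  `|w z' - w z| <= a_beta beta z.1 z.2 * pdist z' z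
     + beta * ((integral_coord z.1)%:R * `|z'.1 - z.1|)
     + beta * ((integral_coord z.2)%:R * `|z'.2 - z.2|).
Proof.
move=> b1 [w_lip w_white]; have b0 : 0 <= beta by lra.
have a1 := a_beta_ge1 z.1 z.2 b1.
have [d1 d10 H1] := adjacent_unit_interval z.1.
have [d2 d20 H2] := adjacent_unit_interval z.2.
exists (Num.min d1 d2); first by rewrite lt_min d10.
move=> z'; rewrite !lt_min => /andP[zd1 _] /andP[_ zd2].
have [i [i1 i2 i3 i4 iF]] := H1 _ zd1; have [j [j1 j2 j3 j4 jF]] := H2 _ zd2.
have ed0 : 0 <= pdist z' z by exact: enorm_ge0.
have h1 := normr_ge0 (z'.1 - z.1); have h2 := normr_ge0 (z'.2 - z.2).
have ae : pdist z' z <= a_beta beta z.1 z.2 * pdist z' z by rewrite ler_peMl.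
have [c1|c1] := boolP (integral_coord z.1); have [c2|c2] := boolP (integral_coord z.2).
all: rewrite /= ?mul1r ?mul0r ?mulr0 ?addr0.
- have := w_lip z' z; move: (enorm_le_sum (z'.1 - z.1) (z'.2 - z.2)).
  rewrite -/(pdist z' z) => /(ler_wpM2l b0); rewrite mulrDr; lra.
- have := w_lip z' (z.1, z'.2); rewrite {1}/pdist/= subrr => h3.
  have {}h3 : `|w z' - w (z.1, z'.2)| <= beta * `|z'.1 - z.1|.
    apply: le_trans h3 _; apply: ler_wpM2l => //.
    by apply: le_trans (enorm_le_sum _ _) _; rewrite normr0 addr0.
  have : `|w (z.1, z'.2) - w z| <= `|z'.2 - z.2|.
    have edE : pdist (z.1, z'.2) z <= `|z'.2 - z.2|.
      by apply: le_trans (enorm_le_sum _ _) _; rewrite /= subrr normr0 add0r.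
    apply: le_trans edE.
    have [k [kE k1 k2]] := even_neighbour j (eqP c1).
    by apply: (w_white k j).
  have := ler_distD (w (z.1, z'.2)) (w z') (w z).
  have := enorm_ge2 (z'.1 - z.1) (z'.2 - z.2); rewrite -/(pdist z' z); lra.
- have := w_lip z' (z'.1, z.2); rewrite {1}/pdist/= subrr => h3.
  have {}h3 : `|w z' - w (z'.1, z.2)| <= beta * `|z'.2 - z.2|.
    apply: le_trans h3 _; apply: ler_wpM2l => //.
    by apply: le_trans (enorm_le_sum _ _) _; rewrite normr0 add0r.
  have : `|w (z'.1, z.2) - w z| <= `|z'.1 - z.1|.
    have edE : pdist (z'.1, z.2) z <= `|z'.1 - z.1|.
      by apply: le_trans (enorm_le_sum _ _) _; rewrite /= subrr normr0 addr0.
    apply: le_trans edE.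
    have [k [kE k1 k2]] := even_neighbour i (eqP c2).
    rewrite addrC in kE.
    by apply: (w_white i k).
  have := ler_distD (w (z'.1, z.2)) (w z') (w z).
  have := enorm_ge1 (z'.1 - z.1) (z'.2 - z.2); rewrite -/(pdist z' z); lra.
- have [e|o] := boolP (2 %| Num.floor z.1 + Num.floor z.2)%Z.
    apply: le_trans ae; apply: (w_white i j) => //.
    by rewrite (iF c1) (jF c2).
  rewrite a_beta_black//.
  + by rewrite lt_neqAle floor_le andbT.
  + by rewrite lt_neqAle floor_le andbT.
Qed.

End plane.

(** * Growth of a calibration along a curve *)

Section length_bound.
Variable R : realType.

Lemma derivable_approx (f : R -> R) (t e : R) : derivable f t 1 -> 0 < e ->
  \forall h \near (0:R), `|f (h + t) - f t - derive1 f t * h| <= e * `|h|.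
Proof.
move=> df e0.
have := df; rewrite /derivable => /cvg_ex[l fl].
have dl : derive1 f t = l.
  by rewrite derive1E /derive; apply/cvg_lim.
move/cvgrPdist_le : fl => /(_ _ e0).
rewrite dl !near_withinE/=.
apply: filterS => h; have [->|h0] := eqVneq h 0.
  by move=> _; rewrite add0r subrr mulr0 subr0 !normr0 mulr0.
move=> /(_ isT); rewrite -ler_pdivrMr ?normr_gt0// -normf_div.
rewrite /GRing.scale /= mulr1; apply: le_trans.
rewrite -normrN le_eqVlt; apply/orP; left; apply/eqP; congr `|_|.
by field.
Qed.

Lemma near0_pos (P : R -> Prop) : (\forall h \near (0:R), P h) -> exists2 h, 0 < h & P h.
Proof.
move=> /nbhs_ballP[h /= h0 Ph]; exists (h / 2); first by rewrite divr_gt0.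
by apply: Ph; rewrite /ball/= sub0r normrN gtr0_norm ?divr_gt0//; lra.
Qed.

(* With [f] the signed distance to a grid line: differentiability of the distance
   at a crossing time forces the normal velocity to vanish there. *)
Lemma abs_derivable_min (f : R -> R) (t : R) :
  f t = 0 -> derivable (fun s => `|f s|) t 1 ->
  forall e, 0 < e -> \forall h \near (0:R), `|f (h + t)| <= e * `|h|.
Proof.
move=> ft0 df e e0.
have d0 : derive1 (fun s => `|f s|) t = 0.
  set d := derive1 _ t.
  suff H c : 0 < c -> `|d| <= c.
    apply/eqP; rewrite -normr_le0; apply/ler_addgt0Pr => c c0.
    by rewrite add0r; exact: H.
  move=> c0; have := derivable_approx df c0; rewrite -/d ft0 normr0.
  move=> /nbhs_ballP[h /= h0 nd]; pose k := h / 2.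
  have k0 : 0 < k by rewrite divr_gt0.
  have kh : k < h by rewrite /k; lra.
  have h1 : `| `|f (k + t)| - 0 - d * k| <= c * `|k|.
    by apply: nd; rewrite /ball/= sub0r normrN gtr0_norm.
  have h2 : `| `|f (- k + t)| - 0 - d * - k| <= c * `|- k|.
    by apply: nd; rewrite /ball/= sub0r opprK gtr0_norm.
  rewrite normrN in h2; rewrite (gtr0_norm k0) in h1 h2.
  move: h1 h2; rewrite !ler_norml => /andP[_ h1] /andP[_ h2].
  have n1 := normr_ge0 (f (k + t)); have n2 := normr_ge0 (f (- k + t)).
  by apply/andP; split; rewrite -(ler_pM2r k0); lra.
have := derivable_approx df e0; apply: filterS => h.
by rewrite d0 mul0r ft0 normr0 !subr0 normr_id.
Qed.

Lemma AC01_comp (u : R -> R * R) (f : R -> R) (K : R) : AC01 u ->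
  (forall x y, `|f y - f x| <= K * enorm ((u y).1 - (u x).1, (u y).2 - (u x).2)) ->
  absolutely_continuous_on `[0, 1]%classic f.
Proof.
move=> acu fu e e0; pose K' := Num.max K 1.
have K'0 : 0 < K' by rewrite lt_max ltr01 orbT.
have [d d0 ud] := acu (e / K') (divr_gt0 e0 K'0).
exists d => // n a b ab disj abd.
apply: le_lt_trans (_ : _ <= K' * \sum_(i < n)
    enorm ((u (b i)).1 - (u (a i)).1, (u (b i)).2 - (u (a i)).2)) _.
  rewrite mulr_sumr; apply: ler_sum => i _; apply: le_trans (fu _ _) _.
  by apply: ler_wpM2r; rewrite ?enorm_ge0// le_max lexx.
rewrite mulrC -ltr_pdivlMr//; apply: ud => // i.
have [] := ab i; rewrite /= !in_itv/= => /andP[-> _] -> /andP[_ ->].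
by [].
Qed.

Section calibration_bound.
Variables (beta eps : R) (w : R * R -> R) (u : R -> R * R).
Hypotheses (beta_gt1 : 1 < beta) (eps_gt0 : 0 < eps).
Hypotheses (cal : calibration beta w) (acu : AC01 u).

Let z t : R * R := ((u t).1 / eps, (u t).2 / eps).
Let f t := eps * w (z t).

Let pdist_z s t : eps * pdist (z s) (z t) =
  enorm ((u s).1 - (u t).1, (u s).2 - (u t).2).
Proof.
rewrite -[X in X * _](gtr0_norm eps_gt0) -enormZ /z/=.
by congr (enorm (_, _)); field; rewrite gt_eqF.
Qed.

Let ac_f : absolutely_continuous_on `[0, 1]%classic f.
Proof.
apply: (AC01_comp (K := beta) acu) => x y.
rewrite -pdist_z /f -mulrBr normrM gtr0_norm// mulrCA ler_pM2l//.
exact: cal.1.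
Qed.

Let ac_u1 c : absolutely_continuous_on `[0, 1]%classic (fun t => (u t).1 - c).
Proof.
apply: (AC01_comp (K := 1) acu) => x y.
by rewrite opprB addrA subrK mul1r enorm_ge1.
Qed.

Let ac_u2 c : absolutely_continuous_on `[0, 1]%classic (fun t => (u t).2 - c).
Proof.
apply: (AC01_comp (K := 1) acu) => x y.
by rewrite opprB addrA subrK mul1r enorm_ge2.
Qed.

Let ac_abs (g : R -> R) : absolutely_continuous_on `[0, 1]%classic g ->
  absolutely_continuous_on `[0, 1]%classic (fun t => `|g t|).
Proof.
apply: ac_dominated (1 : R) _ => x y _ _ _; rewrite mul1r.
exact: ler_dist_dist.
Qed.

(** The distances to the grid lines are absolutely continuous too, and there are countably many
    lines, so all these conditions hold together at almost every time. They make the perpendicular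
    terms of [calibration_local] negligible. *)
Let good t := [/\ derivable (fun s => (u s).1) t 1, derivable (fun s => (u s).2) t 1,
  forall k : int, derivable (fun s => `|(u s).1 - eps * k%:~R|) t 1 &
  forall k : int, derivable (fun s => `|(u s).2 - eps * k%:~R|) t 1].

Let ae_derivable (g : R -> R) : absolutely_continuous_on `[0, 1]%classic g ->
  {ae @lebesgue_measure R, forall t, 0 < t < 1 -> derivable g t 1}.
Proof.
move=> /ac_derivable_ae[h _]; apply: filterS; first exact: (ae_filter_ringOfSetsType lebesgue_measure).
by move=> t H /H[].
Qed.

Let ae_int (P : int -> R -> Prop) :
  (forall k, {ae @lebesgue_measure R, forall t, P k t}) ->
  {ae @lebesgue_measure R, forall t, forall k, P k t}.
Proof.
move=> H; have : {ae @lebesgue_measure R, forall t, forall n : nat, P (odflt 0 (unpickle n)) t}.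
  by apply: ae_foralln => n; exact: H.
apply: filterS; first exact: (ae_filter_ringOfSetsType lebesgue_measure).
by move=> t Ht k; have := Ht (pickle k); rewrite pickleK.
Qed.

Let ae_good : {ae @lebesgue_measure R, forall t, 0 < t < 1 -> good t}.
Proof.
have F := ae_filter_ringOfSetsType (@lebesgue_measure R).
have h1 := ae_derivable (ac_u1 0); have h2 := ae_derivable (ac_u2 0).
have h3 := ae_int (fun k => ae_derivable (ac_abs (ac_u1 (eps * k%:~R)))).
have h4 := ae_int (fun k => ae_derivable (ac_abs (ac_u2 (eps * k%:~R)))).
apply: filterS2 (filterI h1 h2) (filterI h3 h4) => t [g1 g2] [g3 g4] t01; split.
- by have := g1 t01; rewrite (_ : (fun _ => _) = (fun s => (u s).1))//; apply/funext => s; rewrite subr0.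
- by have := g2 t01; rewrite (_ : (fun _ => _) = (fun s => (u s).2))//; apply/funext => s; rewrite subr0.
- by move=> k; exact: g3.
- by move=> k; exact: g4.
Qed.

Let coord_small (g : R -> R) (t e : R) : 0 < e ->
  (forall k : int, derivable (fun s => `|g s - eps * k%:~R|) t 1) ->
  \forall h \near (0:R), (integral_coord (g t / eps))%:R * `|g (h + t) - g t| <= e * `|h|.
Proof.
move=> e0 dg; have [/eqP gk|_] := boolP (integral_coord _); last first.
  by near=> h; rewrite mul0r mulr_ge0// ltW.
have gtE : g t = eps * (Num.floor (g t / eps))%:~R.
  by rewrite gk mulrC divfK// gt_eqF.
pose k := Num.floor (g t / eps).
have gk0 : g t - eps * k%:~R = 0 by rewrite -gtE subrr.
have H := @abs_derivable_min _ t gk0 (dg k) _ e0.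
near=> h; rewrite mul1r [in X in `|X|]gtE.
by near: h; exact: H.
Unshelve. all: by end_near. Qed.

Let growth t : good t -> derivable f t 1 ->
  derive1 f t <= a_beta beta ((u t).1 / eps) ((u t).2 / eps) * speed u t.
Proof.
move=> [du1 du2 dk1 dk2] df.
set a := a_beta _ _ _; set v := speed u t.
have a1 : 1 <= a by exact: a_beta_ge1.
have b0 : 0 < beta by exact: lt_trans ltr01 beta_gt1.
apply/ler_addgt0Pr => e0 e00.
(* One [e] is the error on [f], two per factor [a] come from the coordinates of [u], and two per
   factor [beta] from the grid terms. *)
pose e := e0 / (1 + 2 * a + 2 * beta).
have c0 : 0 < 1 + 2 * a + 2 * beta 
  by rewrite !addr_gt0 ?mulr_gt0//; exact: lt_le_trans ltr01 a1.
have e_gt0 : 0 < e by rewrite divr_gt0.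
have [d d0 loc] := calibration_local (z t) beta_gt1 cal.
have ediv0 : 0 < d * eps by rewrite mulr_gt0.
have cont (g : R -> R) : derivable g t 1 -> \forall h \near (0:R), `|g (h + t) - g t| < d * eps.
  move=> dg; pose L := `|derive1 g t| + 1.
  have L0 : 0 < L by rewrite ltr_wpDl.
  near=> h.
  have h1 : `|g (h + t) - g t - derive1 g t * h| <= 1 * `|h|.
    by near: h; exact: derivable_approx.
  have h2 : `|h| < d * eps / L.
    near: h; apply/nbhs_ballP; exists (d * eps / L); first exact: divr_gt0.
    by move=> x; rewrite /ball/= sub0r normrN.
  rewrite ltr_pdivlMr// in h2; apply: le_lt_trans h2.
  rewrite -[X in `|X|](subrK (derive1 g t * h)).
  apply: le_trans (ler_normD _ _) _; rewrite normrM /L mulrDr; lra.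
have [h h0 [[H1 H2] [Hf [[C1 C2] [K1 K2]]]]] := near0_pos
  (filterI (filterI (derivable_approx du1 e_gt0) (derivable_approx du2 e_gt0))
  (filterI (derivable_approx df e_gt0) (filterI (filterI (cont _ du1) (cont _ du2))
    (filterI (coord_small (g := fun s => (u s).1) e_gt0 dk1)
             (coord_small (g := fun s => (u s).2) e_gt0 dk2))))).
have hn : `|h| = h by rewrite gtr0_norm.
have divE (x y : R) : eps * `|x / eps - y / eps| = `|x - y|.
  by rewrite -mulrBl normrM (gtr0_norm (x := eps^-1)) ?invr_gt0// mulrC divfK// gt_eqF.
have {}loc : `|f (h + t) - f t| <= a * enorm ((u (h + t)).1 - (u t).1, (u (h + t)).2 - (u t).2)
   + beta * ((integral_coord (z t).1)%:R * `|(u (h + t)).1 - (u t).1|)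
   + beta * ((integral_coord (z t).2)%:R * `|(u (h + t)).2 - (u t).2|).
  have zlt (x y : R) : `|x - y| < d * eps -> `|x / eps - y / eps| < d.
    by rewrite -divE mulrC ltr_pM2r.
  have := loc (z (h + t)) (zlt _ _ C1) (zlt _ _ C2).
  rewrite -(ler_pM2l eps_gt0) -[X in X * `|_|](gtr0_norm eps_gt0) -normrM mulrBr.
  move=> /le_trans; apply; rewrite -pdist_z -(divE (u (h + t)).1) -(divE (u (h + t)).2) /z/= le_eqVlt; apply/orP; left.
  by rewrite -/a; apply/eqP; ring.
rewrite hn in H1 H2 Hf K1 K2.
have H3 : enorm ((u (h + t)).1 - (u t).1, (u (h + t)).2 - (u t).2) <= v * h + 2 * (e * h).
  set r1 := _ - derive1 (fun s => (u s).1) t * h in H1.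
  set r2 := _ - derive1 (fun s => (u s).2) t * h in H2.
  have -> : (u (h + t)).1 - (u t).1 = h * derive1 (fun s => (u s).1) t + r1 by rewrite /r1; ring.
  have -> : (u (h + t)).2 - (u t).2 = h * derive1 (fun s => (u s).2) t + r2 by rewrite /r2; ring.
  apply: le_trans (enormD _ _ _ _) _; rewrite enormZ hn -/(speed u t) -/v.
  have := enorm_le_sum r1 r2; lra.
rewrite -(ler_pM2r h0).
have e0E : e0 = e * (1 + 2 * a + 2 * beta) by rewrite /e divfK// gt_eqF.
have a0 : 0 <= a by exact: le_trans ler01 a1.
have := ler_wpM2l a0 H3; have := ler_wpM2l (ltW b0) K1; have := ler_wpM2l (ltW b0) K2.
move: Hf; rewrite ler_norml => /andP[Hf _].
have := ler_norm (f (h + t) - f t).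
rewrite e0E; nra.
Unshelve. all: by end_near. Qed.

Lemma calibration_length_ge :
  ((f 1 - f 0)%:E <= olength beta eps u)%E.
Proof.
apply: ac_growth => //.
  move=> t; rewrite mulr_ge0 ?enorm_ge0//.
  by apply: le_trans (a_beta_ge1 _ _ beta_gt1).
apply: filterS ae_good; first exact: (ae_filter_ringOfSetsType lebesgue_measure).
by move=> t g t01 df; exact: growth (g t01) df.
Qed.

End calibration_bound.
End length_bound.

(** * Construction of calibrations *)

Section gluing.
Variable R : realType.
Implicit Types (x y s t : R) (z : R * R).

(** The data form a relation because the edges of a square prescribe values twice at its corners;
    the Lipschitz condition at distance zero makes them agree. *)
Lemma mcshane (S : R * R -> R -> Prop) (L : R) : 0 <= L ->
  (exists z r, S z r) ->
  (forall z r z' r', S z r -> S z' r' -> r - r' <= L * pdist z z') ->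
  exists2 g : R * R -> R, (forall z r, S z r -> g z = r) &
    forall z z', `|g z - g z'| <= L * pdist z z'.
Proof.
move=> L0 [z0 [r0 S0]] SL.
pose E z := [set v | exists z' r, S z' r /\ v = r + L * pdist z z'].
have E0 z : E z !=set0 by exists (r0 + L * pdist z z0), z0, r0.
have tri z1 z2 z3 : L * pdist z1 z3 <= L * pdist z1 z2 + L * pdist z2 z3.
  by rewrite -mulrDr ler_wpM2l// pdist_triangle.
have Elb z : lbound (E z) (r0 - L * pdist z z0).
  move=> _ [z' [r [Szr ->]]].
  by have := SL _ _ _ _ S0 Szr; have := tri z0 z z'; rewrite (pdistC z0 z); lra.
have Ehl z : has_lbound (E z) by exists (r0 - L * pdist z z0); exact: Elb.
have one z z' : inf (E z) - inf (E z') <= L * pdist z z'.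
  rewrite lerBlDr -lerBlDl; apply: lb_le_inf => // _ [z1 [r [Szr ->]]].
  rewrite lerBlDl; apply: le_trans (_ : r + L * pdist z z1 <= _).
    by apply: ge_inf => //; exists z1, r.
  by have := tri z z' z1; lra.
exists (fun z => inf (E z)).
  move=> z r Szr; apply/eqP; rewrite eq_le; apply/andP; split.
    apply: ge_inf => //; exists z, r; split => //.
    by rewrite /pdist !subrr /enorm/= expr0n/= addr0 sqrtr0 mulr0 addr0.
  apply: lb_le_inf => // _ [z' [r' [Szr' ->]]].
  by have := SL _ _ _ _ Szr Szr'; lra.
move=> z z'; rewrite ler_norml one andbT.
by have := one z' z; rewrite pdistC; lra.
Qed.

(** The supremum of the times up to which the bound from 0 holds is itself such a time, and the
    local estimate there would push it further unless it is 1. *)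
Lemma local_lip_unit (phi : R -> R) (K : R) :
  (forall t, 0 <= t <= 1 -> exists2 d, 0 < d &
     forall s, 0 <= s <= 1 -> `|s - t| < d -> `|phi s - phi t| <= K * `|s - t|) ->
  `|phi 1 - phi 0| <= K.
Proof.
move=> loc.
pose E := [set t | 0 <= t <= 1 /\ `|phi t - phi 0| <= K * t].
have E0 : E 0 by split; rewrite ?lexx ?ler01// subrr normr0 mulr0.
have Eub : ubound E 1 by move=> t [/andP[_ ->]].
have hsE : has_sup E by split; [exists 0|exists 1].
set c := sup E.
have c0 : 0 <= c by apply: ub_le_sup => //; exists 1.
have c1 : c <= 1 by apply: ge_sup => //; exists 0.
have [d d0 Hd] : exists2 d, 0 < d & forall s, 0 <= s <= 1 -> `|s - c| < d ->
    `|phi s - phi c| <= K * `|s - c| by apply: loc; rewrite c0.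
have [t [/andP[t0 t1] Et] tc] := sup_adherent d0 hsE; rewrite -/c in tc.
have tlec : t <= c by apply: ub_le_sup; [exists 1|split => //; rewrite t0].
have Ec : `|phi c - phi 0| <= K * c.
  have := Hd t; rewrite t0 t1 distrC ger0_norm ?subr_ge0// => /(_ isT).
  rewrite distrC => h; have {}h := h ltac:(lra).
  have := ler_distD (phi t) (phi c) (phi 0).
  by move: h Et; rewrite mulrBr; lra.
have [c_lt1|] := ltP c 1; last first.
  move=> h; have {}h : c = 1 by apply/eqP; rewrite eq_le c1.
  by move: Ec; rewrite h mulr1.
pose s := Num.min (c + d / 2) 1.
have sc : c < s by rewrite lt_min c_lt1 andbT; lra.
have s1 : s <= 1 by rewrite ge_min lexx orbT.
have sd : s <= c + d / 2 by rewrite ge_min lexx.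
suff Es : E s.
  have : s <= c by apply: ub_le_sup => //; exists 1.
  by rewrite leNgt sc.
have s01 : 0 <= s <= 1 by rewrite s1 andbT; lra.
split => //.
have := Hd s s01; rewrite ger0_norm ?subr_ge0 ?(ltW sc)// => h.
have {}h := h ltac:(lra).
have := ler_distD (phi c) (phi s) (phi 0).
by move: h Ec; rewrite mulrBr; lra.
Qed.

Lemma local_lip_plane (w : R * R -> R) (K : R) :
  (forall z, exists2 d, 0 < d & forall z', `|z'.1 - z.1| < d -> `|z'.2 - z.2| < d ->
     `|w z' - w z| <= K * pdist z' z) ->
  forall z z', `|w z - w z'| <= K * pdist z z'.
Proof.
move=> loc z z'.
pose D1 := z.1 - z'.1; pose D2 := z.2 - z'.2.
pose l t : R * R := (z'.1 + t * D1, z'.2 + t * D2).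
have l1 : l 1 = z.
  by rewrite /l !mul1r /D1 /D2 ![z'.1 + _]addrC ![z'.2 + _]addrC !subrK; case: (z).
have l0 : l 0 = z' by rewrite /l !mul0r !addr0; case: (z').
suff H : `|(w \o l) 1 - (w \o l) 0| <= K * enorm (D1, D2) by move: H; rewrite /= l1 l0.
apply: local_lip_unit => t _.
have [d d0 H] := loc (l t).
have P : 0 < `|D1| + `|D2| + 1 by rewrite ltr_wpDl// addr_ge0.
exists (d / (`|D1| + `|D2| + 1)); first by rewrite divr_gt0.
move=> s _; rewrite ltr_pdivlMr// => sd.
have e1 : (l s).1 - (l t).1 = (s - t) * D1 by rewrite /l/=; ring.
have e2 : (l s).2 - (l t).2 = (s - t) * D2 by rewrite /l/=; ring.
have n0 := normr_ge0 (s - t).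
have := H (l s); rewrite e1 e2 !normrM => h.
have b1 : `|s - t| * `|D1| < d.
  by apply: le_lt_trans sd; rewrite ler_wpM2l//; have := normr_ge0 D2; lra.
have b2 : `|s - t| * `|D2| < d.
  by apply: le_lt_trans sd; rewrite ler_wpM2l//; have := normr_ge0 D1; lra.
apply: le_trans (h b1 b2) _; rewrite /pdist e1 e2 enormZ.
by rewrite mulrCA mulrC.
Qed.

Lemma floor_in_square z : in_square (Num.floor z.1) (Num.floor z.2) z.
Proof.
have /andP[h1 h2] := floor_itv z.1; have /andP[h3 h4] := floor_itv z.2.
by rewrite /in_square -!(rmorphD _ _ 1) h1 h3 !ltW.
Qed.

Variables (beta h c : R) (om : R * R -> R).
Hypothesis beta_ge1 : 1 <= beta.

(* Boundary values forced on the slow square with lower left corner (1, 0), in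
   coordinates relative to that corner, by the neighbouring fast squares. *)
Definition slow_boundary z (r : R) : Prop :=
  exists2 s, 0 <= s <= 1 &
  [\/ z = (0, s) /\ r = om (1, s), z = (1, s) /\ r = om (0, s) + h,
      z = (s, 0) /\ r = om (s, 1) + h - c | z = (s, 1) /\ r = om (s, 0) + c].

Hypothesis om_lip : forall z z', `|om z - om z'| <= pdist z z'.
Hypothesis slow_lip : forall z r z' r', slow_boundary z r -> slow_boundary z' r' ->
  r - r' <= beta * pdist z z'.

Lemma glue_calibration : exists w C, calibration beta w /\
  forall z, `|w z - (h / 2 * z.1 + (c - h / 2) * z.2)| <= C.
Proof.
have b0 : 0 <= beta := le_trans ler01 beta_ge1.
have [g gS glip] : exists2 g : R * R -> R, (forall z r, slow_boundary z r -> g z = r) &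
    forall z z', `|g z - g z'| <= beta * pdist z z'.
  apply: mcshane => //; exists (0, 0), (om (1, 0)), 0; first by rewrite lexx ler01.
  by apply: Or41.
(* The linear form with value [h] on [(2, 0)] and [c] on [(1, 1)], two vectors that generate the
   periods of the chessboard. *)
pose p1 := h / 2; pose p2 := c - h / 2.
pose loc (i j : int) z : R * R := (z.1 - i%:~R, z.2 - j%:~R).
(* Translates of one fast and one slow model, raised by the linear form. The slow model lives on the
   square with corner [(1, 0)], where the form already equals [p1]; hence the correction. *)
pose F (i j : int) z := p1 * i%:~R + p2 * j%:~R +
  (if (2 %| i + j)%Z then om (loc i j z) else g (loc i j z) - p1).
pose w z := F (Num.floor z.1) (Num.floor z.2) z.
have g1 s : 0 <= s <= 1 -> g (0, s) = om (1, s).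
  by move=> s01; apply: gS; exists s => //; apply: Or41.
have g2 s : 0 <= s <= 1 -> g (1, s) = om (0, s) + h.
  by move=> s01; apply: gS; exists s => //; apply: Or42.
have g3 s : 0 <= s <= 1 -> g (s, 0) = om (s, 1) + h - c.
  by move=> s01; apply: gS; exists s => //; apply: Or43.
have g4 s : 0 <= s <= 1 -> g (s, 1) = om (s, 0) + c.
  by move=> s01; apply: gS; exists s => //; apply: Or44.
have Fright (i j : int) y : j%:~R <= y <= j%:~R + 1 ->
    F (i + 1) j (i%:~R + 1, y) = F i j (i%:~R + 1, y).
  move=> /andP[y0 y1]; have y01 : 0 <= y - j%:~R <= 1 by apply/andP; split; lra.
  rewrite /F /loc/= !rmorphD/= subrr [_ + 1 - i%:~R]addrAC subrr add0r.
  have [e|o] := boolP (2 %| i + j)%Z.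
    by rewrite ifF ?g1//; [ring|lia].
  by rewrite ifT ?g2// /p1; [field|lia].
have Ftop (i j : int) x : i%:~R <= x <= i%:~R + 1 ->
    F i (j + 1) (x, j%:~R + 1) = F i j (x, j%:~R + 1).
  move=> /andP[y0 y1]; have y01 : 0 <= x - i%:~R <= 1 by apply/andP; split; lra.
  rewrite /F /loc/= !rmorphD/= subrr [_ + 1 - j%:~R]addrAC subrr add0r.
  have [e|o] := boolP (2 %| i + j)%Z.
    by rewrite ifF ?g3// /p2 /p1; [field|lia].
  by rewrite ifT ?g4// /p2 /p1; [field|lia].
(* Floors select half-open squares; the agreement of [F] on common edges extends the formula to
   closed ones. *)
have wF i j z : in_square i j z -> w z = F i j z.
  case: z => x y [/= x0 x1 y0 y1]; rewrite /w/=.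
  have fl : forall (n : int) (v : R), n%:~R <= v -> v <= n%:~R + 1 ->
      Num.floor v = n \/ v = n%:~R + 1 /\ Num.floor v = n + 1.
    move=> n v v0; rewrite le_eqVlt => /predU1P[->|v1].
      by right; split => //; apply: floor_def; rewrite !rmorphD/= lexx ltrDl ltr01.
    by left; apply: floor_def; rewrite v0 rmorphD.
  have [ex|[xE ex]] := fl i x x0 x1; have [ey|[yE ey]] := fl j y y0 y1;
    rewrite ex ey //.
  - by rewrite yE Ftop// x0.
  - by rewrite xE Fright// y0.
  - by rewrite xE yE Fright ?Ftop// ?rmorphD/= ?lexx ?lerDl ?ler01.
have loc_dist i j z z' : pdist (loc i j z) (loc i j z') = pdist z z'.
  by rewrite /pdist /loc/=; congr (enorm (_, _)); ring.
have Flip i j z z' : `|F i j z - F i j z'| <= beta * pdist z z'.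
  rewrite /F opprD addrACA subrr add0r -(loc_dist i j).
  case: ifP => _; last by rewrite opprB addrA subrK.
  by apply: le_trans (om_lip _ _) _; rewrite ler_peMl// enorm_ge0.
exists w, (`|om (0, 0)| + `|g (0, 0)| + `|p1| + `|p1| + `|p2| + beta * 2); split; [split|].
- apply: local_lip_plane => z.
  have [d1 d10 H1] := adjacent_unit_interval z.1.
  have [d2 d20 H2] := adjacent_unit_interval z.2.
  exists (Num.min d1 d2); first by rewrite lt_min d10.
  move=> z'; rewrite !lt_min => /andP[zd1 _] /andP[_ zd2].
  have [i [i1 i2 i3 i4 _]] := H1 _ zd1; have [j [j1 j2 j3 j4 _]] := H2 _ zd2.
  by rewrite !(wF i j).
- move=> i j ij z z' zs zs'; rewrite !(wF i j)// /F ij.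
  by rewrite opprD addrACA subrr add0r -(loc_dist i j).
- move=> z; have [h1 h2 h3 h4] := floor_in_square z.
  set i := Num.floor z.1 in h1 h2; set j := Num.floor z.2 in h3 h4.
  rewrite -/p1 -/p2 /w -/i -/j /F.
  set l := loc i j z.
  have l1 : `|l.1| <= 1 by rewrite ler_norml; apply/andP; split; rewrite /l/=; lra.
  have l2 : `|l.2| <= 1 by rewrite ler_norml; apply/andP; split; rewrite /l/=; lra.
  have ld : pdist l (0, 0) <= 2.
    by apply: le_trans (enorm_le_sum _ _) _; rewrite !subr0; lra.
  have bl : pdist l (0, 0) <= beta * 2.
    by apply: le_trans ld _; rewrite ler_peMl.
  have gl : `|g l| <= `|g (0, 0)| + beta * 2.
    have := glip l (0, 0); have := ler_wpM2l b0 ld.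
    by have := ler_normD (g l - g (0, 0)) (g (0, 0)); rewrite subrK; lra.
  have ol : `|om l| <= `|om (0, 0)| + beta * 2.
    have := om_lip l (0, 0).
    by have := ler_normD (om l - om (0, 0)) (om (0, 0)); rewrite subrK; lra.
  have pl1 : `|p1 * l.1| <= `|p1| by rewrite normrM ler_piMr.
  have pl2 : `|p2 * l.2| <= `|p2| by rewrite normrM ler_piMr.
  set v := (X in `|_ + X - _|).
  have vb : `|v| <= `|om (0, 0)| + `|g (0, 0)| + `|p1| + beta * 2.
    rewrite /v; have := normr_ge0 (om (0, 0)); have := normr_ge0 (g (0, 0)).
    have := normr_ge0 p1; case: ifP => _; first lra.
    by have := ler_normB (g l) p1; lra.
  have -> : p1 * i%:~R + p2 * j%:~R + v - (p1 * z.1 + p2 * z.2) =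
      v - p1 * l.1 - p2 * l.2 by rewrite /l/=; ring.
  apply: le_trans (ler_normB _ _) _.
  by have := ler_normB v (p1 * l.1); lra.
Qed.

End gluing.

Section max_lip.
Variable R : realType.
Implicit Types (a b D : R).

Lemma max_dist_le a b a' b' D : `|a - a'| <= D -> `|b - b'| <= D ->
  `|Num.max a b - Num.max a' b'| <= D.
Proof.
rewrite !ler_norml => /andP[h1 h2] /andP[h3 h4].
by have [?|?] := leP a b; have [?|?] := leP a' b'; apply/andP; split; lra.
Qed.

Lemma min_dist_le a b a' b' D : `|a - a'| <= D -> `|b - b'| <= D ->
  `|Num.min a b - Num.min a' b'| <= D.
Proof.
rewrite !ler_norml => /andP[h1 h2] /andP[h3 h4].
by have [?|?] := leP a b; have [?|?] := leP a' b'; apply/andP; split; lra.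
Qed.

Lemma affine_dist_le (p q r : R) (z z' : R * R) : p ^+ 2 + q ^+ 2 <= 1 ->
  `|p * z.1 + q * z.2 + r - (p * z'.1 + q * z'.2 + r)| <= pdist z z'.
Proof.
move=> pq.
have -> : p * z.1 + q * z.2 + r - (p * z'.1 + q * z'.2 + r) =
  p * (z.1 - z'.1) + q * (z.2 - z'.2) by ring.
have h (p' q' : R) : p' ^+ 2 + q' ^+ 2 <= 1 ->
    p' * (z.1 - z'.1) + q' * (z.2 - z'.2) <= pdist z z'.
  by move=> h; rewrite -[pdist _ _]mul1r; apply: dot_le_enorm; rewrite ?ler01// expr1n.
rewrite ler_norml h// andbT.
by have := h (- p) (- q); rewrite !sqrrN => /(_ pq); lra.
Qed.

End max_lip.

(** * The profile on a fast square and its Lipschitz bounds *)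

Section white_profile.
Variables (R : realType) (A s q c d : R).

(* [c] and [2 - 2 * d] are the increments of the calibration along (1, 1) and
   (2, 0); [(A, s)] is the direction of the refracted ray in the fast phase and
   [q] stands for 1 / sqrt 2. *)
Definition white_profile (z : R * R) : R :=
  Num.max (z.1 - d) (Num.min (z.1 + (c - 1 + d))
    (Num.max (A * z.1 + s * z.2)
       (Num.min (A * z.1 + s * z.2 + (c - A - s)) (q * z.1 + q * z.2)))).

Lemma white_profile_le z u : z.1 - d <= u ->
  z.1 + (c - 1 + d) <= u \/ A * z.1 + s * z.2 <= u /\
    (A * z.1 + s * z.2 + (c - A - s) <= u \/ q * z.1 + q * z.2 <= u) ->
  white_profile z <= u.
Proof.
move=> h1 h2; rewrite /white_profile ge_max h1 ge_min ge_max ge_min /=.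
by case: h2 => [->//|[-> [->|->]]]; rewrite ?orbT.
Qed.

Lemma white_profile_ge z u : z.1 - d >= u \/
  (z.1 + (c - 1 + d) >= u /\ (A * z.1 + s * z.2 >= u \/
    A * z.1 + s * z.2 + (c - A - s) >= u /\ q * z.1 + q * z.2 >= u)) ->
  u <= white_profile z.
Proof.
move=> h; rewrite /white_profile le_max le_min le_max le_min.
by case: h => [->//|[-> [->|[-> ->]]]]; rewrite ?orbT.
Qed.

Hypotheses (As1 : A ^+ 2 + s ^+ 2 = 1) (q2 : q ^+ 2 + q ^+ 2 = 1).
Hypotheses (s_ge0 : 0 <= s) (s_le_q : s <= q) (q_le_A : q <= A).
Hypotheses (d_ge0 : 0 <= d) (dA : A + d <= 1).
Hypotheses (c_ge1 : 1 <= c) (c_le2q : c <= q + q) (As_le_c : A + s <= c).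
Hypothesis cdq : c - 1 + 2 * d <= q.

Lemma white_profile_lip z z' : `|white_profile z - white_profile z'| <= pdist z z'.
Proof.
have aff1 r : `|z.1 + r - (z'.1 + r)| <= pdist z z'.
  have := @affine_dist_le R 1 0 r z z'; rewrite !mul1r !mul0r !addr0; apply.
  by rewrite expr1n expr0n addr0.
have aff2 r : `|A * z.1 + s * z.2 + r - (A * z'.1 + s * z'.2 + r)| <= pdist z z'.
  by apply: affine_dist_le; rewrite As1.
apply: max_dist_le; first exact: aff1.
apply: min_dist_le; first exact: aff1.
apply: max_dist_le; first by have := aff2 0; rewrite !addr0.
apply: min_dist_le; first exact: aff2.
by have := @affine_dist_le R q q 0 z z'; rewrite q2 !addr0; apply.
Qed.

Let q_gt0 : 0 < q.
Proof. by have [//|q0] := ltP 0 q; move: q2 s_ge0 s_le_q => h1 h2 h3; nra. Qed.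

Let q_lt1 : q < 1.
Proof. by move: q2 q_gt0 => h1 h2; nra. Qed.

Local Notation om := white_profile.

(** At the four corners of the unit square the profile agrees with the linear form
    [(1 - d, c - 1 + d)]. Along the edges one-sided bounds suffice, in the shape that serves the
    comparison across a slow square. *)
Lemma profile_right y : 0 <= y <= 1 ->
  [/\ 1 - d <= om (1, y), A + s * y <= om (1, y), c - q * (1 - y) <= om (1, y),
      om (1, y) <= c & om (1, y) <= 1 - d + q * y].
Proof.
move: s_ge0 s_le_q q_le_A d_ge0 dA c_ge1 c_le2q As_le_c cdq q_gt0 q_lt1 => H1 H2 H3 H4 H5 H6 H7 H8 H9 H10 H11.
move=> /andP[y0 y1].
have sy : s * y <= s by rewrite ler_piMr.
have qy : 0 <= q * (1 - y) by rewrite mulr_ge0 ?subr_ge0// ltW.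
have sqy : s * (1 - y) <= q * (1 - y) by rewrite ler_wpM2r// subr_ge0.
have sqy2 : s * y <= q * y by rewrite ler_wpM2r.
split.
- by apply: white_profile_ge => /=; left; lra.
- by apply: white_profile_ge => /=; right; split; [lra|left; lra].
- by apply: white_profile_ge => /=; right; split; [lra|right; split; lra].
- by apply: white_profile_le => /=; [lra|right; split; [lra|left; lra]].
- by apply: white_profile_le => /=; [nra|right; split; [lra|right; lra]].
Qed.

Lemma profile_left y : 0 <= y <= 1 ->
  [/\ om (0, y) <= c - 1 + d, om (0, y) <= c - A - s + s * y, om (0, y) <= q * y,
      0 <= om (0, y) & c - 1 + d - q * (1 - y) <= om (0, y)].
Proof.
move: s_ge0 s_le_q q_le_A d_ge0 dA c_ge1 c_le2q As_le_c cdq q_gt0 q_lt1 => H1 H2 H3 H4 H5 H6 H7 H8 H9 H10 H11.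
move=> /andP[y0 y1].
have sy0 : 0 <= s * y by rewrite mulr_ge0.
have qy0 : 0 <= q * y by rewrite mulr_ge0// ltW.
have qy : 0 <= q * (1 - y) by rewrite mulr_ge0 ?subr_ge0// ltW.
have sqy : s * (1 - y) <= q * (1 - y) by rewrite ler_wpM2r// subr_ge0.
have sqy2 : s * y <= q * y by rewrite ler_wpM2r.
split.
- by apply: white_profile_le => /=; [lra|left; lra].
- by apply: white_profile_le => /=; [lra|right; split; [lra|left; lra]].
- by apply: white_profile_le => /=; [lra|right; split; [lra|right; lra]].
- by apply: white_profile_ge => /=; right; split; [lra|left; lra].
- by apply: white_profile_ge => /=; right; split; [lra|right; split; lra].
Qed.

Lemma profile_top x : 0 <= x <= 1 ->
  [/\ om (x, 1) <= x + (c - 1 + d), om (x, 1) <= c, x + c - 1 <= om (x, 1)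
    & c - 1 + d <= om (x, 1)].
Proof.
move: s_ge0 s_le_q q_le_A d_ge0 dA c_ge1 c_le2q As_le_c cdq q_gt0 q_lt1 => H1 H2 H3 H4 H5 H6 H7 H8 H9 H10 H11.
move=> /andP[x0 x1].
have A0 : 0 < A := lt_le_trans q_gt0 q_le_A.
have Ax0 : 0 <= A * x by rewrite mulr_ge0// ltW.
have Ax : 0 <= A * (1 - x) by rewrite mulr_ge0 ?subr_ge0// ltW.
have Ax1 : A * (1 - x) <= 1 - x by rewrite ler_piMl ?subr_ge0//; lra.
have qx0 : 0 <= q * x by rewrite mulr_ge0// ltW.
have qx1 : q * (1 - x) <= 1 - x by rewrite ler_piMl ?subr_ge0// ltW.
split.
- by apply: white_profile_le => /=; [lra|left; lra].
- by apply: white_profile_le => /=; [lra|right; split; [lra|left; lra]].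
- by apply: white_profile_ge => /=; right; split; [lra|right; split; lra].
- by apply: white_profile_ge => /=; right; split; [lra|right; split; lra].
Qed.

Lemma profile_bottom x : 0 <= x <= 1 ->
  [/\ om (x, 0) <= x, 0 <= om (x, 0), om (x, 0) <= 1 - d & x - d <= om (x, 0)].
Proof.
move: s_ge0 s_le_q q_le_A d_ge0 dA c_ge1 c_le2q As_le_c cdq q_gt0 q_lt1 => H1 H2 H3 H4 H5 H6 H7 H8 H9 H10 H11.
move=> /andP[x0 x1].
have A0 : 0 < A := lt_le_trans q_gt0 q_le_A.
have Ax0 : 0 <= A * x by rewrite mulr_ge0// ltW.
have Ax1 : A * x <= x by rewrite ler_piMl//; lra.
have Ax : 0 <= A * (1 - x) by rewrite mulr_ge0 ?subr_ge0// ltW.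
have qx1 : q * x <= x by rewrite ler_piMl// ltW.
have qx : q * x <= q by rewrite ler_piMr// ltW.
split.
- by apply: white_profile_le => /=; [lra|right; split; [lra|right; lra]].
- by apply: white_profile_ge => /=; right; split; [lra|left; lra].
- by apply: white_profile_le => /=; [lra|right; split; [lra|right; lra]].
- by apply: white_profile_ge => /=; left; lra.
Qed.

Variables (beta B : R).
Hypotheses (beta_ge1 : 1 <= beta) (beta_qq : 1 + q ^+ 2 <= beta ^+ 2).
Hypothesis Bs : B ^+ 2 + s ^+ 2 = beta ^+ 2.
Hypothesis refraction : 2 - 2 * d + c <= 2 * A + s + B.

(** Two points of one edge inherit the estimate of the profile. Every other ordered pair of edges is
    settled by a linear form of norm at most [beta]: zero, [(1, 0)], [(0, q)], [(1, q)] or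
    [(B, s)]. *)
Lemma profile_slow_lip z r z' r' :
  slow_boundary (2 - 2 * d) c om z r -> slow_boundary (2 - 2 * d) c om z' r' ->
  r - r' <= beta * pdist z z'.
Proof.
move: s_ge0 s_le_q q_le_A d_ge0 dA c_ge1 c_le2q As_le_c cdq q_gt0 q_lt1 refraction => H1 H2 H3 H4 H5 H6 H7 H8 H9 H10 H11 H12.
have b0 : 0 <= beta by exact: le_trans beta_ge1.
have dot (p p' : R) : p ^+ 2 + p' ^+ 2 <= beta ^+ 2 ->
    forall z z' : R * R, p * (z.1 - z'.1) + p' * (z.2 - z'.2) <= beta * pdist z z'.
  by move=> h z1 z2; exact: dot_le_enorm.
have b2 : 1 <= beta ^+ 2 by rewrite exprn_ege1.
have D00 (z1 z2 : R * R) : 0 <= beta * pdist z1 z2 by rewrite mulr_ge0// enorm_ge0.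
have D10 (z1 z2 : R * R) : z1.1 - z2.1 <= beta * pdist z1 z2.
  have := dot 1 0; rewrite expr1n expr0n addr0 => /(_ b2 z1 z2).
  by rewrite mul1r mul0r addr0.
have D0q (z1 z2 : R * R) : q * (z1.2 - z2.2) <= beta * pdist z1 z2.
  have := dot 0 q; rewrite expr0n add0r => h; have := h _ z1 z2.
  by rewrite mul0r add0r; apply; apply: le_trans beta_qq; rewrite lerDr.
have D1q (z1 z2 : R * R) : z1.1 - z2.1 + q * (z1.2 - z2.2) <= beta * pdist z1 z2.
  by have := dot 1 q; rewrite expr1n => /(_ beta_qq z1 z2); rewrite mul1r.
have DBs (z1 z2 : R * R) : B * (z1.1 - z2.1) + s * (z1.2 - z2.2) <= beta * pdist z1 z2.
  by apply: dot; rewrite Bs.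
have L (z1 z2 : R * R) : om z1 - om z2 <= beta * pdist z1 z2.
  apply: le_trans (ler_norm _) _; apply: le_trans (white_profile_lip _ _) _.
  by rewrite ler_peMl// enorm_ge0.
have pdist_shift (x y x' y' u v u' v' : R) : x - x' = u - u' -> y - y' = v - v' ->
    pdist (x, y) (x', y') = pdist (u, v) (u', v').
  by rewrite /pdist/= => -> ->.
case=> t t01 h1; case=> t' t01' h2.
case: h1 => -[-> ->]; case: h2 => -[-> ->].
- by have := L (1, t) (1, t'); rewrite (@pdist_shift 1 t 1 t' 0 t 0 t') ?subrr.
- have [? ? ? ? ?] := profile_right t01; have [? ? ? ? ?] := profile_left t01'.
  by apply: le_trans (D00 _ _); lra.
- have [? ? ? ? ?] := profile_right t01; have [? ? ? ?] := profile_top t01'.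
  by apply: le_trans (D0q _ _); rewrite /=; lra.
- have [? ? ? ? ?] := profile_right t01; have [? ? ? ?] := profile_bottom t01'.
  by apply: le_trans (D00 _ _); lra.
(* Across the strip, from left edge to right edge: the pieces with gradient [(A, s)] bound both
   values, and [refraction] leaves at most [B] for the unit of width, as the slow direction [(B, s)]
   allows. *)
- have [? ? ? ? ?] := profile_left t01; have [? ? ? ? ?] := profile_right t01'.
  by apply: le_trans (DBs _ _); rewrite /=; lra.
- have := L (0, t) (0, t'); rewrite (@pdist_shift 0 t 0 t' 1 t 1 t') ?subrr//; lra.
(* From the bottom edge to the right one the slope [(1, q)] is used; with [q ^+ 2 = 1 / 2] its norm
   condition is [beta ^+ 2 >= 3 / 2]. *)
- have [? ? ? ? ?] := profile_left t01; have [? ? ? ?] := profile_top t01'.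
  by apply: le_trans (D1q _ _); rewrite /=; lra.
- have [? ? ? ? ?] := profile_left t01; have [? ? ? ?] := profile_bottom t01'.
  by apply: le_trans (D10 _ _); rewrite /=; lra.
- have [? ? ? ?] := profile_top t01; have [? ? ? ? ?] := profile_right t01'.
  by apply: le_trans (D10 _ _); rewrite /=; lra.
- have [? ? ? ?] := profile_top t01; have [? ? ? ? ?] := profile_left t01'.
  by apply: le_trans (D00 _ _); lra.
- have := L (t, 1) (t', 1); rewrite (@pdist_shift t 1 t' 1 t 0 t' 0) ?subrr//; lra.
- have [? ? ? ?] := profile_top t01; have [? ? ? ?] := profile_bottom t01'.
  by apply: le_trans (D10 _ _); rewrite /=; lra.
- have [? ? ? ?] := profile_bottom t01; have [? ? ? ? ?] := profile_right t01'.
  by apply: le_trans (D1q _ _); rewrite /=; lra.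
- have [? ? ? ?] := profile_bottom t01; have [? ? ? ? ?] := profile_left t01'.
  by apply: le_trans (D0q _ _); rewrite /=; lra.
- have [? ? ? ?] := profile_bottom t01; have [? ? ? ?] := profile_top t01'.
  by apply: le_trans (D1q _ _); rewrite /=; lra.
- have := L (t, 0) (t', 0); rewrite (@pdist_shift t 0 t' 0 t 1 t' 1) ?subrr//; lra.
Qed.

Lemma profile_calibration : exists w C, calibration beta w /\
  forall z, `|w z - ((1 - d) * z.1 + (c - 1 + d) * z.2)| <= C.
Proof.
have [w [C [cal wC]]] := glue_calibration beta_ge1 white_profile_lip profile_slow_lip.
exists w, C; split => // z; have := wC z.
have -> : (2 - 2 * d) / 2 = 1 - d by field.
by have -> : c - (1 - d) = c - 1 + d by ring.
Qed.

End white_profile.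

(** * Symmetries of calibrations and the lower bound for the metric *)

Section calibration_symmetry.
Variables (R : realType) (beta : R).

Definition has_calibration (p1 p2 : R) : Prop := exists w C, calibration beta w /\
  forall z : R * R, `|w z - (p1 * z.1 + p2 * z.2)| <= C.

Lemma has_calibration_swap p1 p2 : has_calibration p1 p2 -> has_calibration p2 p1.
Proof.
move=> [w [C [[w1 w2] wC]]]; exists (fun z => w (z.2, z.1)), C; split; [split|].
- move=> z z'; apply: le_trans (w1 _ _) _.
  by rewrite /pdist /enorm/= [X in Num.sqrt X]addrC.
- move=> i j ij z z' [h1 h2 h3 h4] [h5 h6 h7 h8].
  have ji : (2 %| j + i)%Z by rewrite addrC.
  have <- : pdist (z.2, z.1) (z'.2, z'.1) = pdist z z' by rewrite /pdist /enorm/= addrC.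
  exact: (w2 j i ji).
- by move=> z; have := wC (z.2, z.1); rewrite /= (addrC (p1 * _)).
Qed.

(** The reflection is [1 - x], about the middle of a column, because [- x] would exchange fast and
    slow squares. The resulting shift of the form goes into the constant. *)
Lemma has_calibrationN1 p1 p2 : has_calibration p1 p2 -> has_calibration (- p1) p2.
Proof.
move=> [w [C [[w1 w2] wC]]]; pose r (z : R * R) := (1 - z.1, z.2).
have rdist z z' : pdist (r z) (r z') = pdist z z'.
  rewrite /pdist /enorm/= (_ : 1 - z.1 - (1 - z'.1) = - (z.1 - z'.1)) ?sqrrN//.
  by ring.
exists (w \o r), (C + `|p1|); split; [split|].
- by move=> z z'; rewrite -rdist; exact: w1.
- move=> i j ij z z' [h1 h2 h3 h4] [h5 h6 h7 h8].
  rewrite -rdist; apply: (w2 (- i) j); first by lia.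
    by split; rewrite ?rmorphN /r/=; lra.
  by split; rewrite ?rmorphN /r/=; lra.
- move=> z; have := wC (r z); rewrite /= => h.
  rewrite (_ : _ - _ = (w (r z) - (p1 * (1 - z.1) + p2 * z.2)) + p1); last by ring.
  by apply: le_trans (ler_normD _ _) _; rewrite lerD2r.
Qed.

Lemma has_calibrationN2 p1 p2 : has_calibration p1 p2 -> has_calibration p1 (- p2).
Proof. by move=> /has_calibration_swap/has_calibrationN1/has_calibration_swap. Qed.

Lemma d_eps_ge p1 p2 : 1 < beta -> has_calibration p1 p2 -> exists C : R,
  forall (eps : R) (xi : R * R), 0 < eps ->
  ((p1 * xi.1 + p2 * xi.2 - C * eps)%:E <= d_eps beta eps xi)%E.
Proof.
move=> b1 [w [C [cal wC]]]; exists (2 * C) => eps xi e0.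
apply: le_ereal_inf_tmp => _ [u [acu [u0 u1]] <-].
apply: le_trans (calibration_length_ge b1 e0 cal acu).
rewrite u0 u1 lee_fin -mulrBr /= mul0r.
have := wC (0, 0); have := wC (xi.1 / eps, xi.2 / eps).
rewrite /= !mulr0 addr0 subr0 !ler_norml => /andP[h1 h2] /andP[h3 h4].
have E : p1 * xi.1 + p2 * xi.2 = eps * (p1 * (xi.1 / eps) + p2 * (xi.2 / eps)).
  by field; rewrite gt_eqF.
by rewrite E (mulrC _ eps) -mulrBr ler_pM2l//; lra.
Qed.

End calibration_symmetry.

(** * Curves of bounded optical speed *)

Section chessboard_coefficient.
Variables (R : realType) (beta : R).
Implicit Types (x y : R).

Lemma mod2_unit x : (0 < mod2 x < 1) = ~~ integral_coord x && (2 %| Num.floor x)%Z.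
Proof.
rewrite mod2_floor /integral_coord; have /andP[h1 h2] := floor_itv x.
rewrite rmorphD/= in h2.
have -> : ((Num.floor x)%:~R == x) = ~~ ((Num.floor x)%:~R < x).
  by rewrite lt_neqAle h1 andbT negbK.
rewrite negbK; case: (_ %| _)%Z => /=; last by rewrite andbF; apply/negP => /andP[]; lra.
by rewrite addr0 subr_gt0 andbT; case: (ltP _ x) => //= ?; apply/idP; lra.
Qed.

Lemma mod2_second x : (1 < mod2 x < 2) = ~~ integral_coord x && ~~ (2 %| Num.floor x)%Z.
Proof.
rewrite mod2_floor /integral_coord; have /andP[h1 h2] := floor_itv x.
rewrite rmorphD/= in h2.
have -> : ((Num.floor x)%:~R == x) = ~~ ((Num.floor x)%:~R < x).
  by rewrite lt_neqAle h1 andbT negbK.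
rewrite negbK; case: (_ %| _)%Z => /=; first by rewrite andbF; apply/negP => /andP[]; lra.
rewrite -ltrBlDr subrr subr_gt0 andbT; case: (ltP _ x) => //= ?; apply/idP; lra.
Qed.

(** In terms of parities of floors, the invariance under shifts, reflection and swap becomes integer
    arithmetic. *)
Lemma a_betaE x y : a_beta beta x y =
  if [&& ~~ integral_coord x, ~~ integral_coord y &
    ~~ (2 %| Num.floor x + Num.floor y)%Z] then beta else 1.
Proof.
rewrite /a_beta !mod2_unit !mod2_second.
have -> : (2 %| Num.floor x + Num.floor y)%Z =
    ((2 %| Num.floor x)%Z == (2 %| Num.floor y)%Z) by lia.
by case: (integral_coord x); case: (integral_coord y); case: (2 %| _)%Z; case: (2 %| _)%Z.
Qed.

Lemma a_beta_swap x y : a_beta beta y x = a_beta beta x y.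
Proof. by rewrite !a_betaE addrC andbCA. Qed.

Lemma floorD_int x (m : int) : Num.floor (x + m%:~R) = Num.floor x + m.
Proof.
have /andP[h1 h2] := floor_itv x; rewrite rmorphD/= in h2.
by apply: floor_def; rewrite !rmorphD/=; apply/andP; split; lra.
Qed.

Lemma a_beta_shift x y (m n : int) : (2 %| m + n)%Z ->
  a_beta beta (x + m%:~R) (y + n%:~R) = a_beta beta x y.
Proof.
move=> mn; rewrite !a_betaE /integral_coord !floorD_int !rmorphD/=.
rewrite !(inj_eq (addIr _)).
by have -> : (2 %| Num.floor x + m + (Num.floor y + n))%Z = (2 %| Num.floor x + Num.floor y)%Z by lia.
Qed.

Lemma integral_coord_reflect x : integral_coord (1 - x) = integral_coord x.
Proof.
have H (v : R) : integral_coord v -> integral_coord (1 - v).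
  rewrite /integral_coord => /eqP v0.
  have -> : 1 - v = 0 + (1 - Num.floor v)%:~R by rewrite rmorphB/= v0 add0r.
  by rewrite floorD_int floor0 !rmorphD/= add0r.
by apply/idP/idP => /H//; rewrite subKr.
Qed.

Lemma a_beta_reflect x y : a_beta beta (1 - x) y = a_beta beta x y.
Proof.
rewrite !a_betaE integral_coord_reflect; case: (boolP (integral_coord x)) => //= nx.
have /andP[h1 h2] := floor_itv x; rewrite rmorphD/= in h2.
have h3 : (Num.floor x)%:~R < x by rewrite lt_neqAle h1 andbT.
have -> : Num.floor (1 - x) = - Num.floor x.
  by apply: floor_def; rewrite !rmorphD/= rmorphN; apply/andP; split; lra.
by have -> : (2 %| - Num.floor x + Num.floor y)%Z = (2 %| Num.floor x + Num.floor y)%Z by lia.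
Qed.

Lemma a_beta_diag x : a_beta beta x x = 1.
Proof. by rewrite a_betaE (_ : (2 %| _)%Z) ?andbF//; lia. Qed.

Lemma a_beta_axis x : a_beta beta x 0 = 1.
Proof. by rewrite a_betaE /integral_coord floor0 eqxx andbF. Qed.

Lemma a_beta_white x y (i j : int) : (2 %| i + j)%Z ->
  i%:~R < x < i%:~R + 1 -> j%:~R < y < j%:~R + 1 -> a_beta beta x y = 1.
Proof.
move=> ij /andP[x0 x1] /andP[y0 y1]; rewrite a_betaE.
rewrite (@int_between _ i) ?rmorphD// (@int_between _ j) ?rmorphD//.
by rewrite ij !andbF.
Qed.

Lemma a_beta_le x y : 1 <= beta -> a_beta beta x y <= beta.
Proof. by move=> b1; rewrite a_betaE; case: ifP. Qed.

End chessboard_coefficient.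

Section unit_paths.
Variables (R : realType) (beta : R).
Implicit Types (P Q : R * R) (L : R).

Definition slow_at (u : R -> R * R) (t : R) : Prop :=
  [/\ derivable (fun s => (u s).1) t 1, derivable (fun s => (u s).2) t 1 &
      a_beta beta (u t).1 (u t).2 * speed u t <= 1].

(* Curves travelled at optical speed at most one, so that the duration [L]
   bounds the optical length and no integral is needed to concatenate them. *)
Definition unit_path P Q L : Prop := 0 <= L /\ exists (u : R -> R * R) (K : R) (F : seq R),
  [/\ forall t, t <= 0 -> u t = P, forall t, L <= t -> u t = Q,
      forall s t, pdist (u s) (u t) <= K * `|s - t| &
      forall t, 0 < t < L -> t \notin F -> slow_at u t].

Lemma slow_at_near (u v : R -> R * R) (t : R) :
  (\forall s \near t, u s = v s) -> slow_at u t -> slow_at v t.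
Proof.
move=> uv [d1 d2 h].
have n1 : \forall s \near t, (u s).1 = (v s).1 by near=> s; congr (_.1); near: s.
have n2 : \forall s \near t, (u s).2 = (v s).2 by near=> s; congr (_.2); near: s.
split.
- exact: near_eq_derivable d1.
- exact: near_eq_derivable d2.
- have <- : u t = v t by exact: nbhs_singleton uv.
  suff <- : speed u t = speed v t by [].
  by rewrite /speed !derive1E (near_eq_derive _ n1) (near_eq_derive _ n2).
Unshelve. all: by end_near. Qed.

Lemma slow_at_affine (u v : R -> R * R) (c : R) (t : R) :
  (forall s, v s = u (s - c)) -> slow_at u (t - c) -> slow_at v t.
Proof.
move=> vu; have E (f : R -> R) : derivable f (t - c) 1 ->
    is_derive t 1 (fun s => f (s - c)) (derive1 f (t - c)).
  move=> df; rewrite derive1E.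
  have dg : is_derive t 1 (fun s : R => s - c) (1 : R).
    by rewrite -[X in is_derive _ _ _ X]subr0; apply: is_deriveB.
  have df' : is_derive (t - c) 1 f ('D_1 f (t - c)) by exact: derivableP.
  by rewrite -['D_1 f _]mulr1; apply: (@is_derive1_comp _ f (fun s => s - c)).
move=> [d1 d2 h].
have e1 : (fun s => (v s).1) = (fun s => (u (s - c)).1) by apply/funext => s; rewrite vu.
have e2 : (fun s => (v s).2) = (fun s => (u (s - c)).2) by apply/funext => s; rewrite vu.
have [D1 D1E] := E (fun s => (u s).1) d1; have [D2 D2E] := E (fun s => (u s).2) d2.
split; [by rewrite e1|by rewrite e2|].
rewrite vu; suff -> : speed v t = speed u (t - c) by [].
rewrite !derive1E in D1E D2E; by rewrite /speed e1 e2 !derive1E D1E D2E.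
Qed.

Lemma unit_path_concat P Q S L1 L2 :
  unit_path P Q L1 -> unit_path Q S L2 -> unit_path P S (L1 + L2).
Proof.
move=> [L10 [u1 [K1 [F1 [u10 u1L u1K u1F]]]]] [L20 [u2 [K2 [F2 [u20 u2L u2K u2F]]]]].
split; first exact: addr_ge0.
(* At each time one of the two curves rests at [Q], so the sum minus [Q] follows the other. The
   formula has no case distinction, and the Lipschitz constants simply add; the junction time joins
   the exceptional set. *)
pose v t : R * R := ((u1 t).1 + (u2 (t - L1)).1 - Q.1, (u1 t).2 + (u2 (t - L1)).2 - Q.2).
have v1 t : t <= L1 -> v t = u1 t.
  move=> h; rewrite /v u20; last by rewrite subr_le0.
  by rewrite !addrK; case: (u1 t).
have v2 t : L1 <= t -> v t = u2 (t - L1).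
  move=> h; rewrite /v u1L// [Q.1 + _]addrC [Q.2 + _]addrC !addrK.
  by case: (u2 _).
exists v, (K1 + K2), (F1 ++ L1 :: [seq L1 + x | x <- F2]); split.
- by move=> t t0; rewrite v1 ?u10//; exact: le_trans L10.
- move=> t tL; rewrite v2 ?u2L//; first by rewrite lerBrDl.
  by apply: le_trans tL; rewrite lerDl.
- move=> s t; have h1 := u1K s t; have h2 := u2K (s - L1) (t - L1).
  rewrite (_ : s - L1 - (t - L1) = s - t) in h2; last by ring.
  rewrite mulrDl; apply: le_trans (lerD h1 h2).
  rewrite /pdist /v/=; apply: le_trans (enormD _ _ _ _).
  by rewrite le_eqVlt; apply/orP; left; apply/eqP; congr (enorm (_, _)); ring.
- move=> t /andP[t0 tL]; rewrite mem_cat inE !negb_or => /and3P[tF1 tL1 tF2].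
  case: (ltgtP t L1) tL1 => // tL1 _.
    apply: (@slow_at_near u1); last by apply: u1F; rewrite ?t0.
    by near=> s; rewrite v1// ltW//; near: s; exact: lt_nbhsl.
  apply: (@slow_at_near (fun t => u2 (t - L1))).
    by near=> s; rewrite v2// ltW//; near: s; exact: lt_nbhsr.
  apply: (@slow_at_affine u2 _ L1) => //; apply: u2F.
    by rewrite subr_gt0 tL1/= ltrBlDl.
  by apply: contra tF2 => h; apply/mapP; exists (t - L1) => //; rewrite addrC subrK.
Unshelve. all: by end_near. Qed.

Lemma unit_path_refl P : unit_path P P 0.
Proof.
split => //; exists (fun=> P), 0, [::]; split => //.
  by move=> s t; rewrite mul0r /pdist !subrr /enorm/= expr0n/= addr0 sqrtr0.
by move=> t /andP[/lt_trans h /h]; rewrite ltxx.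
Qed.

Lemma unit_path_sym_map (g : R * R -> R * R) P Q L (s1 s2 : R) :
  s1 ^+ 2 = 1 -> s2 ^+ 2 = 1 ->
  (forall z z', (g z).1 - (g z').1 = s1 * (z.1 - z'.1)) ->
  (forall z z', (g z).2 - (g z').2 = s2 * (z.2 - z'.2)) ->
  (forall z, a_beta beta (g z).1 (g z).2 = a_beta beta z.1 z.2) ->
  unit_path P Q L -> unit_path (g P) (g Q) L.
Proof.
move=> s11 s21 g1 g2 ga [L0 [u [K [F [u0 uL uK uF]]]]]; split => //.
have gd z z' : pdist (g z) (g z') = pdist z z'.
  by rewrite /pdist g1 g2 /enorm/= !exprMn s11 s21 !mul1r.
exists (g \o u), K, F; split.
- by move=> t /u0 <-.
- by move=> t /uL <-.
- by move=> s t; rewrite gd.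
move=> t t0L tF; have [d1 d2 h] := uF t t0L tF.
have e1 : (fun s => (g (u s)).1) = (fun s => (g (u t)).1 - s1 * (u t).1 + s1 * (u s).1).
  by apply/funext => s; rewrite -(subrK (g (u t)).1 (g (u s)).1) g1; ring.
have e2 : (fun s => (g (u s)).2) = (fun s => (g (u t)).2 - s2 * (u t).2 + s2 * (u s).2).
  by apply/funext => s; rewrite -(subrK (g (u t)).2 (g (u s)).2) g2; ring.
have E : forall (f : R -> R) (c c' : R), derivable f t 1 ->
    is_derive t 1 (fun s => c + c' * f s) (c' * derive1 f t).
  move=> f c c' df; rewrite -[X in is_derive _ _ _ X]add0r; apply: is_deriveD.
  rewrite derive1E; have df' : is_derive t 1 f ('D_1 f t) by exact: derivableP.
  exact: is_deriveZ.
have [D1 D1E] := E _ ((g (u t)).1 - s1 * (u t).1) s1 d1.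
have [D2 D2E] := E _ ((g (u t)).2 - s2 * (u t).2) s2 d2.
split; [by rewrite /= e1|by rewrite /= e2|].
rewrite /= ga; suff -> : speed (g \o u) t = speed u t by [].
rewrite !derive1E in D1E D2E; rewrite /speed /= e1 e2 !derive1E D1E D2E.
by rewrite /enorm/= !exprMn s11 s21 !mul1r.
Qed.

Lemma unit_path_shift P Q L (m n : int) : (2 %| m + n)%Z -> unit_path P Q L ->
  unit_path (P.1 + m%:~R, P.2 + n%:~R) (Q.1 + m%:~R, Q.2 + n%:~R) L.
Proof.
move=> mn; apply: (@unit_path_sym_map (fun z => (z.1 + m%:~R, z.2 + n%:~R)) _ _ _ 1 1).
- by rewrite expr1n.
- by rewrite expr1n.
- by move=> z z' /=; ring.
- by move=> z z' /=; ring.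
- by move=> z; rewrite a_beta_shift.
Qed.

Lemma unit_path_reflect P Q L : unit_path P Q L ->
  unit_path (1 - P.1, P.2) (1 - Q.1, Q.2) L.
Proof.
apply: (@unit_path_sym_map (fun z => (1 - z.1, z.2)) _ _ _ (-1) 1).
- by rewrite sqrrN expr1n.
- by rewrite expr1n.
- by move=> z z' /=; ring.
- by move=> z z' /=; ring.
- by move=> z; rewrite a_beta_reflect.
Qed.

Lemma unit_path_swap P Q L : unit_path P Q L -> unit_path (P.2, P.1) (Q.2, Q.1) L.
Proof.
move=> [L0 [u [K [F [u0 uL uK uF]]]]]; split => //.
exists (fun t => ((u t).2, (u t).1)), K, F; split.
- by move=> t /u0 <-.
- by move=> t /uL <-.
- by move=> s t; apply: le_trans (uK s t); rewrite /pdist /enorm/= addrC.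
- move=> t t0L tF; have [d1 d2 h] := uF t t0L tF; split; [exact: d2|exact: d1|].
  rewrite /= a_beta_swap; suff -> : speed (fun t => ((u t).2, (u t).1)) t = speed u t by [].
  by rewrite /speed /enorm/= addrC.
Qed.

End unit_paths.

Section segments.
Variables (R : realType) (beta : R).

Lemma clip_dist (x y : R) : `|clip x - clip y| <= `|x - y|.
Proof.
wlog xy : x y / x <= y => [H|].
  by have [/H//|/ltW/H] := leP x y; rewrite distrC (distrC y).
rewrite distrC (distrC x) !ger0_norm ?subr_ge0 ?clip_nd//.
exact: clip_lip.
Qed.

Lemma unit_path_segment (P Q : R * R) (c : R) : 0 < c ->
  (forall r, 0 < r < 1 ->
    a_beta beta (P.1 + r * (Q.1 - P.1)) (P.2 + r * (Q.2 - P.2)) <= c) ->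
  unit_path beta P Q (c * pdist Q P).
Proof.
move=> c0 ac; set D1 := Q.1 - P.1 in ac *; set D2 := Q.2 - P.2 in ac *.
have eD : pdist Q P = enorm (D1, D2) by [].
set L := c * _.
have L0 : 0 <= L by rewrite mulr_ge0 ?enorm_ge0// ltW.
split => //.
pose at_ r : R * R := (P.1 + r * D1, P.2 + r * D2).
have at0 : at_ 0 = P by rewrite /at_ !mul0r !addr0; case: (P).
have at1 : at_ 1 = Q.
  by rewrite /at_ !mul1r /D1 /D2 [P.1 + _]addrC [P.2 + _]addrC !subrK; case: (Q).
have atd r s : pdist (at_ r) (at_ s) = `|r - s| * enorm (D1, D2).
  by rewrite -enormZ /pdist /at_/=; congr (enorm (_, _)); ring.
exists (fun t => at_ (clip (t / L))), (L^-1 * enorm (D1, D2)), [::]; split.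
- by move=> t t0; rewrite clip_le0// mulr_le0_ge0// invr_ge0.
- move=> t Lt; have [L_gt0|] := ltP 0 L.
    by rewrite clip_ge1// ler_pdivlMr// mul1r.
  (* Division by zero gives zero, so the curve then rests at [P], which coincides with [Q]. *)
  move=> Lle; have {Lle}Le : L = 0 by apply/eqP; rewrite eq_le Lle.
  have e0 : enorm (D1, D2) = 0.
    by move/eqP: Le; rewrite /L mulf_eq0 gt_eqF//= => /eqP; rewrite eD.
  have D10 : D1 = 0.
    by apply/eqP; rewrite -normr_le0 -e0 enorm_ge1.
  have D20 : D2 = 0.
    by apply/eqP; rewrite -normr_le0 -e0 enorm_ge2.
  by rewrite -at1 /at_ D10 D20 !mulr0.
- move=> s t; rewrite atd (mulrC L^-1) -mulrA [X in X <= _]mulrC.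
  apply: ler_wpM2l; first exact: enorm_ge0.
  apply: le_trans (clip_dist _ _) _.
  by rewrite -mulrBl normrM (ger0_norm (x := L^-1)) ?invr_ge0// mulrC.
- move=> t /andP[t0 tL] _.
  have L_gt0 : 0 < L := lt_trans t0 tL.
  have e_gt0 : 0 < enorm (D1, D2) by move: L_gt0; rewrite /L pmulr_rgt0.
  apply: (@slow_at_near _ beta (fun s => at_ (s / L))).
    near=> s; have : s \in `]0, L[ by near: s; apply: near_in_itvoo; rewrite in_itv/= t0.
    rewrite in_itv/= => /andP[s0 sL]; rewrite clip_id//.
    by apply/andP; split; [rewrite divr_ge0// ltW|rewrite ler_pdivrMr// mul1r ltW].
  have dv (x D : R) : is_derive t 1 (fun s => x + s / L * D) (D / L).
    have -> : (fun s => x + s / L * D) = (fun s => x + (D / L) * s).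
      by apply/funext => s; congr (_ + _); rewrite mulrC mulrA mulrAC.
    rewrite -[X in is_derive _ _ _ X]add0r; apply: is_deriveD.
    rewrite -[X in is_derive _ _ _ X]mulr1; exact: is_deriveZ.
  have [d1 d1E] := dv P.1 D1; have [d2 d2E] := dv P.2 D2.
  split; [exact: d1|exact: d2|].
  rewrite /speed /= !derive1E d1E d2E !(mulrC _ L^-1) enormZ gtr0_norm ?invr_gt0//.
  rewrite mulrA -ler_pdivlMr//; apply: le_trans (_ : _ <= c / L) _.
    rewrite ler_pM2r ?invr_gt0// [_^-1 * _]mulrC; apply: ac.
    by rewrite divr_gt0//= ltr_pdivrMr// mul1r.
  by rewrite /L eD invfM mulrA divff ?gt_eqF// mul1r div1r.
Unshelve. all: by end_near. Qed.

Import HBNNSimple.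

(** The bound is proved for each simple function below [S], which is measurable even when [S] is not
    known to be. *)
Lemma ae_bounded_le_integral (S : R -> R) (N : set R) (M : R) :
  countable N -> (forall t, 0 <= S t) -> 0 <= M ->
  (forall t, 0 <= t <= 1 -> ~ N t -> S t <= M) ->
  (\int[@lebesgue_measure R]_(t in `[0%R, 1%R]) (S t)%:E <= M%:E)%E.
Proof.
move=> cN S0 M0 SM.
have mN : measurable N by exact: countable_measurable.
have N0 : lebesgue_measure N = 0%E by exact: countable_lebesgue_measure0.
rewrite ge0_integralE; last by move=> x _; rewrite lee_fin.
apply: ge_ereal_sup => _ [g /= gS <-].
rewrite -integralT_nnsfun.
have <- : (\int[@lebesgue_measure R]_(t in `[0%R, 1%R]) M%:E = M%:E)%E.
  rewrite integral_cst//=; set m := lebesgue_measure _.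
  have -> : m = 1%E; last by rewrite mule1.
  by rewrite /m lebesgue_measure_itv/= lte_fin ltr01 sube0.
rewrite [leRHS]integral_mkcond; apply: ae_ge0_le_integral => //.
- by move=> x _; rewrite lee_fin.
- by apply/measurable_EFinP; exact: measurable_funPT.
- by move=> x _ /=; rewrite patchE; case: ifP => //; rewrite lee_fin.
- by apply/(measurable_restrictT _ _).1; first exact: measurable_itv.
exists N; split => // x /= nx; apply: contrapT => Nx; apply: nx => _.
apply: le_trans (gS x) _; rewrite !patchE; case: ifPn => // /set_mem/=.
by rewrite in_itv/= => x01; rewrite lee_fin; exact: SM.
Qed.

Lemma d_eps_le (Q : R * R) (L eps : R) : 1 < beta -> 0 < eps ->
  unit_path beta (0, 0) Q L ->
  (d_eps beta eps (eps * Q.1, eps * Q.2)%R <= (eps * L)%:E)%E.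
Proof.
move=> b1 e0 [L0 [u [K [F [u0 uL uK uF]]]]].
(* Space is scaled by [eps] and the duration [L] is brought to 1, which multiplies the speed by
   [L * eps]. *)
pose v t : R * R := (eps * (u (L * t)).1, eps * (u (L * t)).2).
have vd s t : pdist (v s) (v t) <= (`|K| * eps * L) * `|s - t|.
  have -> : pdist (v s) (v t) = eps * pdist (u (L * s)) (u (L * t)).
    by rewrite -[X in X * _](gtr0_norm e0) -enormZ /pdist/=; congr (enorm (_, _)); ring.
  rewrite (mulrC `|K|) -!mulrA ler_pM2l//.
  apply: le_trans (uK _ _) _; rewrite -mulrBr normrM (ger0_norm L0).
  by apply: ler_wpM2r; rewrite ?mulr_ge0// ler_norm.
apply: ge_ereal_inf; exists (olength beta eps v).
  exists v => //; split; last split.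
  - move=> e ee; pose K' := `|K| * eps * L + 1.
    have K'0 : 0 < K' by rewrite ltr_wpDl// !mulr_ge0// ltW.
    exists (e / K'); first by rewrite divr_gt0.
    move=> n a b ab _; rewrite ltr_pdivlMr// mulrC; apply: le_lt_trans.
    rewrite mulr_sumr; apply: ler_sum => i _; have [_ [h _]] := ab i.
    apply: le_trans (vd _ _) _; rewrite (ger0_norm (x := b i - a i)) ?subr_ge0//.
    by rewrite ler_wpM2r ?subr_ge0// lerDl.
  - by rewrite /v mulr0 u0//= mulr0.
  - by rewrite /v mulr1 uL.
pose N := [set` [seq x / L | x <- F]] `|` [set 0; 1] : set R.
apply: (@ae_bounded_le_integral _ N).
- apply: finite_set_countable; rewrite finite_setU; split; first exact: finite_seq.
  exact: finite_set2.
- move=> t; rewrite mulr_ge0 ?enorm_ge0//.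
  by apply: le_trans (a_beta_ge1 _ _ b1).
- by rewrite mulr_ge0// ltW.
move=> t /andP[t0 t1] Nt.
have t_gt0 : 0 < t.
  by rewrite lt_neqAle t0 andbT; apply/eqP => h; apply: Nt; right; left.
have t_lt1 : t < 1.
  by rewrite lt_neqAle t1 andbT; apply/eqP => h; apply: Nt; right; right.
rewrite /v /= !(mulrC eps) !mulfK ?gt_eqF//.
have [Lgt0|] := ltP 0 L; last first.
  move=> Lle; have Le : L = 0 by apply/eqP; rewrite eq_le Lle.
  rewrite /speed/= Le; have z (f : R -> R) : (fun s : R => eps * f (0 * s)) = cst (eps * f 0).
    by apply/funext => s; rewrite mul0r.
  rewrite (z (fun s => (u s).1)) (z (fun s => (u s).2)).
  by rewrite !derive1_cst /enorm/= expr0n/= addr0 sqrtr0 mulr0 mul0r.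
have LtF : L * t \notin F.
  apply/negP => h; apply: Nt; left; apply/mapP; exists (L * t) => //.
  by rewrite mulrC mulKf// gt_eqF.
have Lt01 : 0 < L * t < L by rewrite mulr_gt0//= gtr_pMr.
have [d1 d2 h] := uF _ Lt01 LtF.
have E : forall f : R -> R, derivable f (L * t) 1 ->
    is_derive t 1 (fun s => eps * f (L * s)) (L * eps * derive1 f (L * t)).
  move=> f df; rewrite derive1E.
  have dg : is_derive t 1 (fun s : R => L * s) L.
    by rewrite -[X in is_derive _ _ _ X]mulr1; exact: is_deriveZ.
  have df' : is_derive (L * t) 1 f ('D_1 f (L * t)) by exact: derivableP.
  have dc : is_derive t 1 (fun s => f (L * s)) ('D_1 f (L * t) * L).
    exact: (@is_derive1_comp _ f (fun s => L * s)).
  have -> : L * eps * 'D_1 f (L * t) = eps * ('D_1 f (L * t) * L) by ring.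
  exact: is_deriveZ.
have [_ D1] := E _ d1; have [_ D2] := E _ d2.
have -> : speed (fun t => (eps * (u (L * t)).1, eps * (u (L * t)).2)) t =
    L * eps * speed u (L * t).
  rewrite /speed/=; rewrite !derive1E in D1 D2; rewrite !derive1E D1 D2 enormZ.
  by rewrite ger0_norm// mulr_ge0// ltW.
rewrite mulrCA (mulrC L) ler_piMr// mulr_ge0//; exact: ltW.
Qed.

End segments.

(** * Snell's law and the critical value *)

Section refraction.
Variable R : realType.
Implicit Types (b s : R).

Let snell b s := 2 * s / Num.sqrt (1 - s ^+ 2) + s / Num.sqrt (b ^+ 2 - s ^+ 2).

Lemma snell_solution b : 1 <= b -> exists s, 0 < s < 1 /\ snell b s = 1.
Proof.
move=> b1; have b2 : 1 <= b ^+ 2 by rewrite exprn_ege1.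
(* At [3 / 5] the first term of [snell] is [3 / 2], already above 1, by the triple 3, 4, 5; the
   interval stays away from the singularity at 1. *)
have sq s : s \in `[0, 3 / 5] -> [/\ 0 <= s, s <= 3 / 5 & s ^+ 2 <= 9 / 25].
  by rewrite in_itv/= => /andP[s0 s1]; split => //; rewrite expr2; nra.
have s0 : snell b 0 = 0 by rewrite /snell mulr0 !mul0r addr0.
have s1 : 1 <= snell b (3 / 5).
  rewrite /snell (_ : 1 - (3 / 5) ^+ 2 = (4 / 5) ^+ 2); last by field.
  rewrite sqrtr_sqr ger0_norm; last by lra.
  have : 0 <= 3 / 5 / Num.sqrt (b ^+ 2 - (3 / 5) ^+ 2) by rewrite mulr_ge0// invr_ge0 sqrtr_ge0.
  by rewrite (_ : 2 * (3 / 5) / (4 / 5) = 3 / 2); [lra|field].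
have cont : {within `[0, 3 / 5]%classic, continuous (snell b)}.
  apply: continuous_in_subspaceT => s /set_mem /= sI.
  have [_ _ ss] := sq s sI.
  have p1 : 0 < Num.sqrt (1 - s ^+ 2) by rewrite sqrtr_gt0; lra.
  have p2 : 0 < Num.sqrt (b ^+ 2 - s ^+ 2) by rewrite sqrtr_gt0; lra.
  have csq (c : R) : (fun x => Num.sqrt (c - x ^+ 2)) x @[x --> s] --> Num.sqrt (c - s ^+ 2).
    apply: (@continuous_comp _ _ _ (fun x : R => c - x ^+ 2) Num.sqrt).
      by apply: cvgB; [exact: cvg_cst|exact: exprn_continuous].
    exact: sqrt_continuous.
  apply: cvgD; apply: cvgM.
  - by apply: cvgM; [exact: cvg_cst|exact: cvg_id].
  - by apply: cvgV; [rewrite gt_eqF|exact: csq].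
  - exact: cvg_id.
  - by apply: cvgV; [rewrite gt_eqF|exact: csq].
have [||s /sq[s_ge0 s_le ss] sE] := @IVT R (snell b) 0 (3 / 5) 1 _ cont.
- by lra.
- by rewrite s0 ge_min ler01 le_max s1 orbT.
exists s; split => //; apply/andP; split; last by lra.
rewrite lt_neqAle s_ge0 andbT; apply/eqP => s00.
by move: sE; rewrite -s00 s0 => /eqP; rewrite eq_sym oner_eq0.
Qed.

Lemma sigma3P b : 1 <= b -> 0 < sigma3 b < 1 /\ snell b (sigma3 b) = 1.
Proof. by move=> b1; apply: xgetPex (snell_solution b1). Qed.

(* [(A, s)] and [(B, s) / b] are the unit directions of the refracted ray in the
   two phases, and [Lambda3 b] is its length by Snell's law. *)
Lemma Lambda3_snell b : 1 <= b -> exists A B,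
  [/\ 0 < A, 0 < B, A ^+ 2 + sigma3 b ^+ 2 = 1, B ^+ 2 + sigma3 b ^+ 2 = b ^+ 2 &
    2 * (sigma3 b / A) + sigma3 b / B = 1 /\
    Lambda3 b = 2 / A + b ^+ 2 / B /\ Lambda3 b = 2 * A + sigma3 b + B].
Proof.
move=> b1; have [/andP[s0 s1] sE] := sigma3P b1; set s := sigma3 b in s0 s1 sE *.
have b2 : 1 <= b ^+ 2 by rewrite exprn_ege1.
have ss : s ^+ 2 < 1 by rewrite expr2; nra.
pose A := Num.sqrt (1 - s ^+ 2); pose B := Num.sqrt (b ^+ 2 - s ^+ 2).
have A0 : 0 < A by rewrite sqrtr_gt0; lra.
have B0 : 0 < B by rewrite sqrtr_gt0; lra.
have A2 : A ^+ 2 + s ^+ 2 = 1 by rewrite sqr_sqrtr ?subrK//; lra.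
have B2 : B ^+ 2 + s ^+ 2 = b ^+ 2 by rewrite sqr_sqrtr ?subrK//; lra.
exists A, B; split => //; split; last split => //.
  by rewrite mulrA.
rewrite /Lambda3 -/s -/A -/B -B2.
have -> : 2 / A = 2 * (A ^+ 2 + s ^+ 2) / A by rewrite A2 mulr1.
have -> : 2 * (A ^+ 2 + s ^+ 2) / A + (B ^+ 2 + s ^+ 2) / B =
    2 * A + B + s * (2 * s / A + s / B) by field; rewrite !gt_eqF.
by rewrite [2 * s / A + s / B]sE mulr1 addrAC.
Qed.

(** Fermat's principle: each segment is paired with the refracted direction of its phase. All these
    directions have the same vertical component [s], so the heights add up to [s] and the sum is
    [2 * A + s + B]. *)
Lemma Lambda3_le b y1 y2 y3 : 1 <= b -> y1 + y2 + y3 = 1 ->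
  Lambda3 b <= enorm (1, y1) + b * enorm (1, y2) + enorm (1, y3).
Proof.
move=> b1 yE; have [A [B [A0 B0 A2 B2 [_ [_ ->]]]]] := Lambda3_snell b1.
set s := sigma3 b in A2 B2 *.
have h1 : A * 1 + s * y1 <= 1 * enorm (1, y1).
  by apply: dot_le_enorm; rewrite ?ler01// A2 expr1n.
have h2 : B * 1 + s * y2 <= b * enorm (1, y2).
  by apply: dot_le_enorm; rewrite ?B2// (le_trans ler01 b1).
have h3 : A * 1 + s * y3 <= 1 * enorm (1, y3).
  by apply: dot_le_enorm; rewrite ?ler01// A2 expr1n.
have : s * y1 + s * y2 + s * y3 = s by rewrite -!mulrDr yE mulr1.
by lra.
Qed.

Lemma Lambda3_attained b : 1 <= b -> exists r t, [/\ 0 < r, 0 < t, 2 * r + t = 1 &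
  Lambda3 b = enorm (1, r) + b * enorm (1, t) + enorm (1, r)].
Proof.
move=> b1; have b0 : 0 < b := lt_le_trans ltr01 b1.
have [A [B [A0 B0 A2 B2 [sE [-> _]]]]] := Lambda3_snell b1.
have [/andP[s0 _] _] := sigma3P b1; set s := sigma3 b in A2 B2 sE s0 *.
exists (s / A), (s / B); split => //; rewrite ?divr_gt0//.
have e1 : enorm (1, s / A) = 1 / A.
  have -> : (1, s / A) = (A^-1 * A, A^-1 * s) :> R * R.
    by rewrite mulVf ?gt_eqF// mulrC.
  by rewrite enormZ gtr0_norm ?invr_gt0// /enorm/= A2 sqrtr1 mulr1 div1r.
have e2 : enorm (1, s / B) = b / B.
  have -> : (1, s / B) = (B^-1 * B, B^-1 * s) :> R * R.
    by rewrite mulVf ?gt_eqF// mulrC.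
  by rewrite enormZ gtr0_norm ?invr_gt0// /enorm/= B2 sqrtr_sqr gtr0_norm// mulrC.
by rewrite e1 e2; field; rewrite !gt_eqF.
Qed.

(** As a minimum of lengths that increase with [b], [Lambda3] is monotone, with no need to
    differentiate [sigma3]. *)
Lemma Lambda3_homo b b' : 1 <= b -> b <= b' -> Lambda3 b <= Lambda3 b'.
Proof.
move=> b1 bb'; have [r [t [r0 t0 rt ->]]] := Lambda3_attained (le_trans b1 bb').
apply: le_trans (@Lambda3_le b r t r b1 _) _; first by lra.
by rewrite lerD2r lerD2l ler_wpM2r// enorm_ge0.
Qed.

Lemma Lambda3_lip b b' : 1 <= b -> 1 <= b' -> Lambda3 b' - Lambda3 b <= 2 * `|b' - b|.
Proof.
move=> b1 b'1; have [r [t [r0 t0 rt ->]]] := Lambda3_attained b1.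
have h1 := @Lambda3_le b' r t r b'1 ltac:(lra).
have h2 : enorm (1, t) <= 2.
  by apply: le_trans (enorm_le_sum _ _) _; rewrite normr1 gtr0_norm//; lra.
have h3 : (b' - b) * enorm (1, t) <= 2 * `|b' - b|.
  apply: le_trans (_ : _ <= `|b' - b| * enorm (1, t)) _.
    by rewrite ler_wpM2r ?enorm_ge0// ler_norm.
  by rewrite mulrC ler_wpM2r.
by move: h3; rewrite mulrBl; lra.
Qed.

(** The lower bound is a continued fraction convergent; [7 / 5] would be too coarse for the estimate
    at [sqrt (3 / 2)]. *)
Lemma sqrt2_bounds : 41 / 29 <= Num.sqrt (2 : R) <= 3 / 2.
Proof.
apply/andP; split.
  by rewrite -[leLHS]ger0_norm ?divr_ge0// -sqrtr_sqr ler_wsqrtr//; lra.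
by rewrite -[leRHS]ger0_norm ?divr_ge0// -sqrtr_sqr ler_wsqrtr//; lra.
Qed.

Lemma sqr_sqrt2 : Num.sqrt 2 ^+ 2 = 2 :> R.
Proof. by rewrite sqr_sqrtr. Qed.

Lemma sqr_sqrt32 : Num.sqrt (3 / 2) ^+ 2 = 3 / 2 :> R.
Proof. by rewrite sqr_sqrtr// divr_ge0. Qed.

Lemma sqrt32_ge1 : 1 <= Num.sqrt (3 / 2 : R).
Proof. by rewrite -{1}sqrtr1 ler_wsqrtr//; lra. Qed.

Lemma Lambda3_sqrt32 : Lambda3 (Num.sqrt (3 / 2)) < 2 + Num.sqrt (2 : R).
Proof.
(* Rational slopes close to those of the refracted ray for this coefficient. *)
have h := @Lambda3_le (Num.sqrt (3 / 2)) (9 / 25) (7 / 25) (9 / 25) sqrt32_ge1 ltac:(lra).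
apply: le_lt_trans h _.
have e1 : enorm (1, 9 / 25) <= (16 / 15 : R) by apply: enorm_le_sqr; rewrite ?divr_ge0//; lra.
have e2 : enorm (1, 7 / 25) <= (26 / 25 : R) by apply: enorm_le_sqr; rewrite ?divr_ge0//; lra.
have e3 : Num.sqrt (3 / 2) <= (49 / 40 : R).
  by rewrite -[leRHS]ger0_norm ?divr_ge0// -sqrtr_sqr ler_wsqrtr//; lra.
have := ler_pM (sqrtr_ge0 (3 / 2)) (enorm_ge0 (1, 7 / 25)) e3 e2.
by have /andP[h1 _] := sqrt2_bounds; lra.
Qed.

Lemma Lambda3_sqrt2 : 2 + Num.sqrt 2 < Lambda3 (Num.sqrt (2 : R)).
Proof.
have /andP[h1 h2] := sqrt2_bounds.
have [r [t [r0 t0 rt ->]]] := @Lambda3_attained (Num.sqrt 2) ltac:(lra).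
(* A rational lower certificate: the two vectors share the vertical component [5 / 13] and have
   norms at most 1 and [sqrt 2]. *)
have h3 : 12 / 13 * 1 + 5 / 13 * r <= 1 * enorm (1, r).
  by apply: dot_le_enorm; rewrite ?ler01//; lra.
have h4 : 34 / 25 * 1 + 5 / 13 * t <= Num.sqrt 2 * enorm (1, t).
  by apply: dot_le_enorm; rewrite ?sqrtr_ge0// sqr_sqrt2; lra.
lra.
Qed.

Lemma sigma_hat2 b : sigma_hat 2 b = sigma3 b.
Proof.
have f2 : Num.floor (2 : R) = 2 by apply: floor_def; apply/andP; split; lra.
have q2 : qn (2 : R) = 1 by rewrite /qn f2 /=; lra.
have p2 : pn (2 : R) = 2 by rewrite /pn q2; lra.
rewrite /sigma_hat /sigma3 p2 q2; congr (xget _ _).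
by apply/funext => s /=; rewrite mul1r.
Qed.

(** Compares the refracted ray to [(3, 1)] with a diagonal followed by a grid line of length 2. *)
Lemma l_len2 b : l_len 2 b = Lambda3 b - (2 + Num.sqrt 2).
Proof.
have f2 : Num.floor (2 : R) = 2 by apply: floor_def; apply/andP; split; lra.
have q2 : qn (2 : R) = 1 by rewrite /qn f2 /=; lra.
have p2 : pn (2 : R) = 2 by rewrite /pn q2; lra.
by rewrite /l_len /Lambda3 /= sigma_hat2 p2 q2 mulr1; ring.
Qed.

Lemma beta0cP : 1 < beta0c R < Num.sqrt 2 /\ Lambda3 (beta0c R) = 2 + Num.sqrt 2.
Proof.
suff : exists b : R, 1 < b < Num.sqrt 2 /\ l_len 2 b = 0.
  move=> /xgetPex -/(_ 0)[h1 h2]; split => //.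
  by apply/eqP; rewrite -subr_eq0 -l_len2; apply/eqP.
have l1 := Lambda3_sqrt32; have l2 := Lambda3_sqrt2; have s1 := sqrt32_ge1.
have ss : Num.sqrt (3 / 2) <= Num.sqrt (2 : R) by rewrite ler_wsqrtr//; lra.
(* The Lipschitz bound holds for coefficients at least 1; [Num.max 1] keeps nearby points in this
   range and changes nothing on the interval. *)
have cont : {within `[Num.sqrt (3 / 2), Num.sqrt 2]%classic, continuous (@Lambda3 R \o Num.max 1)}.
  apply: continuous_in_subspaceT => x _.
  apply/cvgrPdist_lt => e e0; near=> y.
  have m1 (v : R) : 1 <= Num.max 1 v by rewrite le_max lexx.
  have h : `|Lambda3 (Num.max 1 x) - Lambda3 (Num.max 1 y)| <= 2 * `|Num.max 1 x - Num.max 1 y|.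
    rewrite ler_norml Lambda3_lip// andbT.
    by have := Lambda3_lip (m1 x) (m1 y); rewrite distrC; lra.
  have h2 : `|Num.max 1 x - Num.max 1 y| <= `|x - y|.
    have a1 := ler_norm (x - y); have := ler_norm (y - x); rewrite distrC => a2.
    have a3 := normr_ge0 (x - y).
    by have [?|?] := leP 1 x; have [?|?] := leP 1 y; rewrite ler_norml; apply/andP; split; lra.
  have h3 : `|x - y| < e / 2 by near: y; apply: cvgr_dist_lt; [exact: cvg_id|exact: divr_gt0].
  by rewrite /=; lra.
have s2 := le_trans s1 ss.
have [|b bI bE] := @IVT R _ _ _ (2 + Num.sqrt 2) ss cont.
  by rewrite /= (max_r s1) (max_r s2) ge_min le_max (ltW l1) (ltW l2) orbT.
move: bI; rewrite in_itv/= => /andP[b1 b2].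
have b_ge1 := le_trans s1 b1; rewrite /= max_r// in bE.
exists b; split; last by rewrite l_len2 bE subrr.
apply/andP; split; rewrite lt_neqAle ?b2 ?b_ge1 andbT; apply/eqP => bb.
  have s1b : Num.sqrt (3 / 2) = 1 :> R by apply/eqP; rewrite eq_le s1 andbT; move: b1; rewrite -bb.
  by move: sqr_sqrt32; rewrite s1b expr1n; lra.
by rewrite bb in bE; lra.
Unshelve. all: by end_near. Qed.

Lemma Lambda3_ge_beta0c b : beta0c R <= b -> 2 + Num.sqrt 2 <= Lambda3 b.
Proof.
by have [/andP[/ltW h _] <-] := beta0cP; exact: Lambda3_homo.
Qed.

Lemma Lambda3_le_beta0c b : 1 <= b -> b <= beta0c R -> Lambda3 b <= 2 + Num.sqrt 2.
Proof. by move=> b1; have [_ <-] := beta0cP; exact: Lambda3_homo. Qed.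

(** Makes the calibrations, built for [beta] at least [sqrt (3 / 2)], available above the critical
    value. *)
Lemma sqrt32_le_beta0c : Num.sqrt (3 / 2) <= beta0c R.
Proof.
have [/andP[/ltW h _] E] := beta0cP; rewrite leNgt; apply/negP => /ltW h2.
by have := Lambda3_homo h h2; rewrite E; have := Lambda3_sqrt32; lra.
Qed.

End refraction.

(** * The homogenized metric *)

Section homogenized_metric.
Variables (R : realType) (beta : R).
Hypothesis beta_gt1 : 1 < beta.

Let beta_ge1 : 1 <= beta := ltW beta_gt1.
Let beta_gt0 : 0 < beta := lt_trans ltr01 beta_gt1.

Lemma unit_path_any (P Q : R * R) : unit_path beta P Q (beta * pdist Q P).
Proof. by apply: unit_path_segment => // r _; exact: a_beta_le. Qed.

Lemma unit_path_diag : unit_path beta (0, 0) (1, 1) (Num.sqrt 2).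
Proof.
have -> : Num.sqrt 2 = 1 * pdist (1, 1) (0, 0) :> R.
  by rewrite mul1r /pdist /= !subr0 /enorm/= expr1n.
by apply: unit_path_segment => // r _; rewrite /= !subr0 !mulr1 a_beta_diag.
Qed.

Lemma unit_path_axis : unit_path beta (0, 0) (2, 0) 2.
Proof.
have {2}-> : 2 = 1 * pdist (2, 0) (0, 0) :> R.
  by rewrite mul1r /pdist /= !subr0 /enorm/= expr0n/= addr0 sqrtr_sqr ger0_norm.
by apply: unit_path_segment => // r _; rewrite /= !subr0 mulr0 addr0 a_beta_axis.
Qed.

Lemma unit_path_refracted : unit_path beta (0, 0) (3, 1) (Lambda3 beta).
Proof.
have [r [t [r0 t0 rt ->]]] := Lambda3_attained beta_ge1.
(* The ray crosses a fast, a slow and a fast square. On the middle piece the crude bound by [beta]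
   already gives the required length. *)
apply: unit_path_concat; first apply: (@unit_path_concat _ _ _ (1, r) (2, 1 - r)).
- have -> : enorm (1, r) = 1 * pdist (1, r) (0, 0) by rewrite mul1r /pdist/= !subr0.
  apply: unit_path_segment => // k /andP[k0 k1]; rewrite /= !subr0 mulr1 !add0r.
  rewrite (@a_beta_white _ _ _ _ 0 0)//; first by rewrite add0r k0.
  by rewrite add0r mulr_gt0//=; nra.
- have -> : enorm (1, t) = pdist (2, 1 - r) (1, r).
    by rewrite /pdist/=; congr (enorm (_, _)); lra.
  exact: unit_path_any.
- have -> : enorm (1, r) = 1 * pdist (3, 1) (2, 1 - r).
    by rewrite mul1r /pdist/=; congr (enorm (_, _)); lra.
  apply: unit_path_segment => // k /andP[k0 k1] /=.
  rewrite (@a_beta_white _ _ _ _ 2 0)//; apply/andP; split; nra.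
Qed.

Lemma unit_path_iter (m n : int) (l : R) (k : nat) : (2 %| m + n)%Z ->
  unit_path beta (0, 0) (m%:~R, n%:~R) l ->
  unit_path beta (0, 0) (k%:R * m%:~R, k%:R * n%:~R) (k%:R * l).
Proof.
move=> mn ml; elim: k => [|k IH].
  by rewrite !mul0r; exact: unit_path_refl.
have -> : k.+1%:R * l = k%:R * l + l by rewrite -natr1 mulrDl mul1r.
apply: unit_path_concat IH _.
have kmn : (2 %| k%:Z * m + k%:Z * n)%Z by rewrite -mulrDr dvdz_mull.
have := unit_path_shift kmn ml; rewrite /= !add0r !rmorphM/= -!pmulrn.
by rewrite -natr1 !mulrDl !mul1r [m%:~R + _]addrC [n%:~R + _]addrC.
Qed.

(** [s] stands for [1 / eps]; the constant [C], uniform in [s], disappears in the limit after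
    multiplication by [eps]. *)
Definition has_upper_path (x y N : R) : Prop := exists C : R, forall s, 0 < s ->
  exists2 L, L <= s * N + C & unit_path beta (0, 0) (s * x, s * y) L.

Lemma has_upper_path_comb (m1 n1 m2 n2 : int) (l1 l2 a b : R) :
  (2 %| m1 + n1)%Z -> (2 %| m2 + n2)%Z ->
  unit_path beta (0, 0) (m1%:~R, n1%:~R) l1 -> unit_path beta (0, 0) (m2%:~R, n2%:~R) l2 ->
  0 <= a -> 0 <= b ->
  has_upper_path (a * m1%:~R + b * m2%:~R) (a * n1%:~R + b * n2%:~R) (a * l1 + b * l2).
Proof.
move=> e1 e2 p1 p2 a0 b0.
exists (beta * (`|m1%:~R| + `|m2%:~R| + (`|n1%:~R| + `|n2%:~R|))) => s s0.
(* Both multiplicities are rounded down to integers; the remaining gap is bounded independently of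
   [s] and is closed by a straight segment. *)
have /truncn_itv/andP[k1 k1'] : 0 <= s * a by rewrite mulr_ge0// ltW.
have /truncn_itv/andP[k2 k2'] : 0 <= s * b by rewrite mulr_ge0// ltW.
set i := Num.truncn (s * a) in k1 k1'; set j := Num.truncn (s * b) in k2 k2'.
rewrite -natr1 in k1'; rewrite -natr1 in k2'.
have q1 := unit_path_iter i e1 p1.
have ej : (2 %| i%:Z * m1 + i%:Z * n1)%Z by rewrite -mulrDr dvdz_mull.
have := unit_path_shift ej (unit_path_iter j e2 p2).
rewrite /= !add0r !rmorphM/= -!pmulrn => q2.
have q12 := unit_path_concat q1 q2.
set Q := (X in unit_path _ _ X) in q12.
pose T : R * R := (s * (a * m1%:~R + b * m2%:~R), s * (a * n1%:~R + b * n2%:~R)).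
exists (i%:R * l1 + j%:R * l2 + beta * pdist T Q); last first.
  exact: unit_path_concat q12 (unit_path_any _ _).
have l10 : 0 <= l1 by case: p1.
have l20 : 0 <= l2 by case: p2.
have r1 : `|s * a - i%:R| <= 1 by rewrite ger0_norm; lra.
have r2 : `|s * b - j%:R| <= 1 by rewrite ger0_norm; lra.
have h1 := ler_wpM2r l10 k1; have h2 := ler_wpM2r l20 k2.
have TQ : pdist T Q <= `|m1%:~R| + `|m2%:~R| + (`|n1%:~R| + `|n2%:~R|).
  have bd (u v u' v' : R) : `|u| <= 1 -> `|v| <= 1 -> `|u * u' + v * v'| <= `|u'| + `|v'|.
    move=> hu hv; apply: le_trans (ler_normD _ _) _; rewrite !normrM.
    by apply: lerD; rewrite ler_piMl.
  apply: le_trans (enorm_le_sum _ _) _; apply: lerD; rewrite /T /Q /=.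
    rewrite (_ : _ - _ = (s * a - i%:R) * m1%:~R + (s * b - j%:R) * m2%:~R); last by ring.
    exact: bd.
  rewrite (_ : _ - _ = (s * a - i%:R) * n1%:~R + (s * b - j%:R) * n2%:~R); last by ring.
  exact: bd.
have := ler_wpM2l (ltW beta_gt0) TQ.
have -> : s * (a * l1 + b * l2) = s * a * l1 + s * b * l2 by ring.
lra.
Qed.

Lemma has_upper_path_swap x y N : has_upper_path x y N -> has_upper_path y x N.
Proof.
move=> [C H]; exists C => s /H[L LN p]; exists L => //.
exact: (unit_path_swap p).
Qed.

Lemma has_upper_pathN1 x y N : has_upper_path x y N -> has_upper_path (- x) y N.
Proof.
(* The reflection moves both endpoints by one unit; two unit segments, each of cost at most [beta],
   repair this. *)
move=> [C H]; exists (C + beta + beta) => s s0; have [L LN p] := H s s0.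
have := unit_path_reflect p; rewrite /= subr0 => p1.
have h : forall P Q : R * R, pdist Q P = 1 -> unit_path beta P Q beta.
  by move=> P Q e; have := unit_path_any P Q; rewrite e mulr1.
exists (beta + L + beta); first by lra.
apply: unit_path_concat (h (1 - s * x, s * y) _ _).
  apply: unit_path_concat p1; apply: h.
  by rewrite /pdist/= !subr0 /enorm/= expr1n expr0n/= addr0 sqrtr1.
rewrite /pdist/= subrr (_ : s * - x - (1 - s * x) = - 1); last by ring.
by rewrite /enorm/= sqrrN expr1n expr0n/= addr0 sqrtr1.
Qed.

Lemma has_upper_path_sym x y N :
  has_upper_path (Num.max `|x| `|y|) (Num.min `|x| `|y|) N -> has_upper_path x y N.
Proof.
have abs1 u v : has_upper_path `|u| v N -> has_upper_path u v N.
  have [u0|u0] := ger0P u; first by [].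
  by move=> /has_upper_pathN1; rewrite opprK.
have abs u v : has_upper_path `|u| `|v| N -> has_upper_path u v N.
  by move=> /abs1/has_upper_path_swap/abs1/has_upper_path_swap.
have [h|h] := leP `|x| `|y|; last exact: abs.
by move=> /has_upper_path_swap; exact: abs.
Qed.

Lemma has_calibration_sym (p1 p2 x y : R) : has_calibration beta p1 p2 ->
  exists p1' p2', has_calibration beta p1' p2' /\
    p1' * x + p2' * y = p1 * Num.max `|x| `|y| + p2 * Num.min `|x| `|y|.
Proof.
move=> cal.
have abs (u v r1 r2 : R) : has_calibration beta r1 r2 -> exists p1' p2',
    has_calibration beta p1' p2' /\ p1' * u + p2' * v = r1 * `|u| + r2 * `|v|.
  move=> c; have [u0|u0] := ger0P u; have [v0|v0] := ger0P v.
  - by exists r1, r2.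
  - by exists r1, (- r2); split; [exact: has_calibrationN2|ring].
  - by exists (- r1), r2; split; [exact: has_calibrationN1|ring].
  - by exists (- r1), (- r2); split; [exact/has_calibrationN1/has_calibrationN2|ring].
have [h|h] := leP `|x| `|y|; last exact: abs.
have [r1 [r2 [c e]]] := abs x y _ _ (has_calibration_swap cal).
by exists r1, r2; split => //; rewrite e addrC.
Qed.

Lemma Phi_eq (x y N p1 p2 : R) : has_upper_path x y N ->
  has_calibration beta p1 p2 -> p1 * x + p2 * y = N -> Phi beta (x, y) = N%:E.
Proof.
move=> [C1 H1] cal pN; have [C2 H2] := d_eps_ge beta_gt1 cal.
have lin (C : R) : (N + C * eps)%:E @[eps --> 0^'+] --> N%:E.
  apply: cvg_EFin; first by near=> e.
  rewrite -[X in _ --> X]addr0 -[X in _ --> _ + X](mulr0 C).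
  apply: cvgD; first exact: cvg_cst.
  apply: cvgM; first exact: cvg_cst.
  exact: cvg_within.
apply/cvg_lim => //.
apply: (squeeze_cvge _ (lin (- C2)) (lin C1)).
near=> e; have e0 : 0 < e by near: e; exact: nbhs_right_gt.
apply/andP; split; first by rewrite -pN mulNr; exact: H2.
have [L LN p] := H1 e^-1 ltac:(by rewrite invr_gt0).
have := d_eps_le beta_gt1 e0 p; rewrite /= !mulVKf ?gt_eqF// => /le_trans; apply.
rewrite lee_fin; apply: le_trans (ler_wpM2l (ltW e0) LN) _.
by rewrite mulrDr mulVKf ?gt_eqF// (mulrC e).
Unshelve. all: by end_near. Qed.

Lemma Phi_max_min (x y N p1 p2 : R) :
  has_upper_path (Num.max `|x| `|y|) (Num.min `|x| `|y|) N ->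
  has_calibration beta p1 p2 ->
  p1 * Num.max `|x| `|y| + p2 * Num.min `|x| `|y| = N -> Phi beta (x, y) = N%:E.
Proof.
move=> up cal pN; have [r1 [r2 [cal' e]]] := has_calibration_sym x y cal.
by apply: (Phi_eq (has_upper_path_sym up) cal'); rewrite e.
Qed.

Hypothesis beta_ge : Num.sqrt (3 / 2) <= beta.

Let s3 := sigma3 beta.
Let sqrt2 := Num.sqrt (2 : R).

Lemma refraction_bounds : exists A B, [/\ A ^+ 2 + s3 ^+ 2 = 1, B ^+ 2 + s3 ^+ 2 = beta ^+ 2,
  Lambda3 beta = 2 * A + s3 + B, 1 / 4 <= s3 /\ 5 * s3 ^+ 2 <= 1 &
  [/\ 89 / 100 <= A, 57 / 50 <= B & sqrt2 <= s3 + B]].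
Proof.
have [A [B [A0 B0 A2 B2 [sE [_ LE]]]]] := Lambda3_snell beta_ge1.
have [/andP[s0 _] _] := sigma3P beta_ge1; rewrite -/s3 in A2 B2 sE LE s0.
have b32 : 3 / 2 <= beta ^+ 2.
  by rewrite -sqr_sqrt32 ler_pXn2r// nnegrE ?sqrtr_ge0// ltW.
have lt_sqr (x y : R) : 0 <= x -> 0 < y -> x ^+ 2 < y ^+ 2 -> x < y.
  by move=> x0 y0; rewrite ltr_pXn2r// nnegrE ?ltW.
exists A, B.
have sB : 0 < s3 / B by rewrite divr_gt0.
(* Both terms of Snell's equation are positive, so the fast one is below 1. With
   [A ^+ 2 + s3 ^+ 2 = 1] this bounds [s3] above, hence [A] and [B] below. *)
have sA : 2 * s3 < A.
  have : s3 / A < 1 / 2 by lra.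
  by rewrite ltr_pdivrMr//; lra.
have s5 : 5 * s3 ^+ 2 <= 1.
  have : (2 * s3) ^+ 2 <= A ^+ 2 by rewrite ler_pXn2r ?nnegrE ?ltW// mulr_gt0.
  by rewrite exprMn; lra.
have A89 : 89 / 100 <= A by apply/ltW/lt_sqr => //; lra.
have B57 : 57 / 50 <= B by apply/ltW/lt_sqr => //; lra.
suff s4 : 1 / 4 <= s3.
  split => //; split => //.
  rewrite -(@ler_pXn2r _ 2) ?nnegrE ?sqrtr_ge0//; last by lra.
  rewrite sqr_sqrt2 sqrrD.
  have : 1 / 4 * (57 / 50) <= s3 * B by rewrite ler_pM//; lra.
  by lra.
(* If [s3] were below [1 / 4], then [A] and [B] would be so large that the terms of Snell's equation
   could not add up to 1. *)
rewrite leNgt; apply/negP => s4.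
have ss : s3 ^+ 2 < 1 / 16.
  by have := lt_sqr s3 (1 / 4); rewrite !expr2; nra.
have A1 : 24 / 25 < A by apply: lt_sqr => //; lra.
have B1 : 119 / 100 < B by apply: lt_sqr => //; lra.
have h1 : s3 / A < 25 / 96 by rewrite ltr_pdivrMr//; lra.
have h2 : s3 / B < 25 / 119 by rewrite ltr_pdivrMr//; lra.
lra.
Qed.

(** The alternatives for [c] and [d] cover the three forms in use. The number [22 / 100] is
    [2 * (1 - 89 / 100)]: since [sqrt2 <= s3 + B], it bounds [2 + sqrt2 - Lambda3 beta]. The same
    inequality yields [A + d <= 1] when [d] is nonzero. *)
Lemma refracted_calibration (c d : R) : 1 <= c -> c <= sqrt2 ->
  0 <= d -> 2 * d <= 22 / 100 ->
  2 - 2 * d + c <= Lambda3 beta ->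
  c = sqrt2 \/ c = Lambda3 beta - 2 ->
  d = 0 \/ 2 * d = 2 + sqrt2 - Lambda3 beta ->
  has_calibration beta (1 - d) (c - 1 + d).
Proof.
move=> c1 c2 d0 d1 ref ce de.
have [A [B [A2 B2 LE [s1 s2] [A1 B1 sBq]]]] := refraction_bounds.
pose q := sqrt2 / 2.
have b1 := beta_ge1; have b0 := beta_gt0.
have /andP[r1 r2] := sqrt2_bounds R; rewrite -/sqrt2 in r1 r2.
have r22 : sqrt2 ^+ 2 = 2 by exact: sqr_sqrt2.
have b32 : 3 / 2 <= beta ^+ 2.
  by rewrite -sqr_sqrt32 ler_pXn2r// nnegrE ?sqrtr_ge0// ltW.
have q2 : q ^+ 2 = 1 / 2 by rewrite /q expr_div_n r22; field.
have rq : sqrt2 = q + q by rewrite /q; lra.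
have A_le1 : A <= 1 by rewrite !expr2 in A2 *; nra.
have sAq : A + s3 <= sqrt2.
  rewrite -(@ler_pXn2r _ 2) ?nnegrE//; try lra.
  by rewrite r22 sqrrD; have := sqr_ge0 (A - s3); rewrite sqrrB; lra.
have sq : s3 <= q.
  rewrite -(@ler_pXn2r _ 2) ?nnegrE//; try lra.
have qA : q <= A by lra.
have dA : A + d <= 1 by case: de => [->|]; lra.
have As : A + s3 <= c by case: ce => [->//|]; lra.
apply: (@profile_calibration R A s3 q c d _ _ _ _ _ _ _ _ _ _ _ beta B) => //; try lra.
Qed.

(** This form is exact on [(1, 1)] and [(2, 0)], the flat one on [(2, 0)] and [(3, 1)], the steep
    one on [(1, 1)] and [(3, 1)]; the hypothesis on [Lambda3] says that the value on the third
    vector does not exceed its length. *)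
Lemma calibration_diag : 2 + sqrt2 <= Lambda3 beta -> has_calibration beta 1 (sqrt2 - 1).
Proof.
move=> h; have /andP[r1 r2] := sqrt2_bounds R; rewrite -/sqrt2 in r1 r2.
have := @refracted_calibration sqrt2 0; rewrite subr0 addr0; apply; first [lra|by left].
Qed.

Lemma calibration_flat : Lambda3 beta <= 2 + sqrt2 ->
  has_calibration beta 1 (Lambda3 beta - 3).
Proof.
move=> h; have [A [B [A2 B2 LE [s1 s2] [A1 B1 sBq]]]] := refraction_bounds.
have := @refracted_calibration (Lambda3 beta - 2) 0.
rewrite subr0 addr0 (_ : Lambda3 beta - 2 - 1 = Lambda3 beta - 3); last by ring.
apply; first [lra|by left|by right].
Qed.

Lemma calibration_steep : Lambda3 beta <= 2 + sqrt2 ->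
  has_calibration beta ((Lambda3 beta - sqrt2) / 2) ((3 * sqrt2 - Lambda3 beta) / 2).
Proof.
move=> h; have [A [B [A2 B2 LE [s1 s2] [A1 B1 sBq]]]] := refraction_bounds.
have /andP[r1 r2] := sqrt2_bounds R; rewrite -/sqrt2 in r1 r2.
pose d := (2 + sqrt2 - Lambda3 beta) / 2.
have -> : (Lambda3 beta - sqrt2) / 2 = 1 - d by rewrite /d; field.
have -> : (3 * sqrt2 - Lambda3 beta) / 2 = sqrt2 - 1 + d by rewrite /d; field.
have d2 : 2 * d = 2 + sqrt2 - Lambda3 beta by rewrite /d; field.
apply: refracted_calibration; first [lra|by left|by right].
Qed.

End homogenized_metric.

Theorem theorem6p3 (R : realType) (beta : R) : 1 < beta ->
  forall x y : R,
    let M := Num.max `|x| `|y| in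
    let m := Num.min `|x| `|y| in
    (beta0c R <= beta ->
       Phi beta (x, y) = (M + (Num.sqrt 2 - 1) * m)%:E) /\
    (Num.sqrt (3 / 2) <= beta <= beta0c R ->
       (3 * m <= M -> Phi beta (x, y) = (M + (Lambda3 beta - 3) * m)%:E) /\
       (M <= 3 * m -> Phi beta (x, y) =
          ((Lambda3 beta - Num.sqrt 2) / 2 * M
           + (3 * Num.sqrt 2 - Lambda3 beta) / 2 * m)%:E)).
Proof.
move=> beta_gt1 x y M m.
have m0 : 0 <= m by rewrite le_min !normr_ge0.
have mM : m <= M by rewrite /M /m; case: (leP `|x| `|y|) => // /ltW.
have p1 := unit_path_diag beta; have p2 := unit_path_axis beta.
have p3 := unit_path_refracted beta_gt1.
split=> [b0|/andP[b32 b0]].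
  have b32 := le_trans (sqrt32_le_beta0c R) b0.
  apply: (Phi_max_min beta_gt1 _ (calibration_diag beta_gt1 b32 (Lambda3_ge_beta0c b0))).
    (* The coefficients decompose [(M, m)] along the generators of its cone; their nonnegativity is
       exactly the condition of the case, here and in the two cases below. *)
    have := @has_upper_path_comb R beta beta_gt1 1 1 2 0 _ _ m ((M - m) / 2) isT isT p1 p2 m0 ltac:(lra).
    by congr has_upper_path; rewrite -/M -/m; field.
  by rewrite -/M -/m mul1r.
have L2 := Lambda3_le_beta0c (ltW beta_gt1) b0.
split=> mM3.
  apply: (Phi_max_min beta_gt1 _ (calibration_flat beta_gt1 b32 L2)).
    have := @has_upper_path_comb R beta beta_gt1 3 1 2 0 _ _ m ((M - 3 * m) / 2) isT isT p3 p2 m0 ltac:(lra).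
    by congr has_upper_path; rewrite -/M -/m; field.
  by rewrite -/M -/m mul1r.
apply: (Phi_max_min beta_gt1 _ (calibration_steep beta_gt1 b32 L2)) => //.
have := @has_upper_path_comb R beta beta_gt1 3 1 1 1 _ _ ((M - m) / 2) ((3 * m - M) / 2) isT isT p3 p1 ltac:(lra) ltac:(lra).
by congr has_upper_path; rewrite -/M -/m; field.
Qed.
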